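(* Let $p,q\ge1$ be integers with $\gcd(p,q)=1$, $n=p+q$, let $\ell\in\mathbb{Z}$ and $a\in\mathbb{C}$. Write $\varepsilon_r=\exp(2\pi i/r)$; a hat over a parameter means it is omitted. (i) Near $\zeta=0$, for arbitrary fixed $g>0$ and for $\kappa=0,\dots,q-1$, $$\zeta^{\kappa/q}\,{}_nF_{n-1}\left(\begin{array}{l}\frac{a}n+\frac{\kappa}q,\dots,\frac{a+(n-1)}n+\frac{\kappa}q\\ \frac{a-\ell+1}p+\frac{\kappa}q,\dots,\frac{a-\ell+p}p+\frac{\kappa}q;\ \frac1q+\frac{\kappa}q,\dots,\widehat{\frac{q-\kappa}q+\frac{\kappa}q},\dots,\frac{q}q+\frac{\kappa}q\end{array}\mid\zeta\right)$$ $$=\frac{(-1)^\kappa(1)_\kappa(a+n\kappa/q)_{1-\ell-\kappa}}{(a)_{1-\ell}}\left[\frac{(-1)^qn^n}{p^pq^q}\right]^{\kappa/q}\cdot\frac1q\sum_{j=1}^q(\varepsilon_q^{-n})^{(j-1)\kappa}\,[\varepsilon_q^{j-1}g^{-1/q}x_j]^{-qa}\,F_\ell(-a,-p/q;\,g^{-1}x_j^q),$$ where $x_j$ ($j=1,\dots,q$) is the root of $x^n-g\,x^p-\beta=0$ near $\varepsilon_q^{-(j-1)}g^{1/q}$ (for $\beta$ near $0$), with $\beta$ determined by $\zeta=(-1)^q\frac{n^n}{p^pq^q}\frac{\beta^q}{g^n}$. (ii) Near $\zeta=\infty$, for arbitrary fixed $\beta>0$ and for $\kappa=0,\dots,n-1$,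 $$\zeta^{-\kappa/n}\,{}_nF_{n-1}\left(\begin{array}{l}\frac{-a+\ell}p+\frac{\kappa}n,\dots,\frac{-a+\ell+(p-1)}p+\frac{\kappa}n;\ \frac{a}q+\frac{\kappa}n,\dots,\frac{a+(q-1)}q+\frac{\kappa}n\\ \frac1n+\frac{\kappa}n,\dots,\widehat{\frac{n-\kappa}n+\frac{\kappa}n},\dots,\frac{n}n+\frac{\kappa}n\end{array}\mid\zeta^{-1}\right)$$ $$=\frac{(-1)^\kappa(1)_\kappa(a+q\kappa/n)_{1-\ell-\kappa}}{(a)_{1-\ell}}\left[\frac{(-1)^qn^n}{p^pq^q}\right]^{-\kappa/n}\cdot\frac1n\sum_{j=1}^n(\varepsilon_n^{-q})^{(j-1)\kappa}\,[\varepsilon_n^{j-1}\beta^{-1/n}x_j]^{-na}\,F_\ell(-a,p/n;\,\beta^{-1}x_j^n),$$ where $x_j$ ($j=1,\dots,n$) is the root of $x^n-g\,x^p-\beta=0$ near $\varepsilon_n^{-(j-1)}\beta^{1/n}$ (for $g$ near $0$), with $g$ determined by $\zeta=(-1)^q\frac{n^n}{p^pq^q}\frac{\beta^q}{g^n}$. In (i) and (ii), $a$ is constrained so that no division by zero occurs, and (in (i)) so that no lower parameter of any ${}_nF_{n-1}$, for any $\kappa$, is a non-positive integer.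
   Context: Branch convention: in (i), $\zeta^{1/q}$, $[(-1)^qn^n/(p^pq^q)]^{1/q}$ and $\beta$ may be chosen arbitrarily subject to $\zeta^{1/q}=[(-1)^qn^n/(p^pq^q)]^{1/q}\,g^{-n/q}\beta$; in (ii), similarly, subject to $\zeta^{-1/n}=[(-1)^qn^n/(p^pq^q)]^{-1/n}\,\beta^{-q/n}g$. Here $g^{1/q}$ and $\beta^{1/n}$ are positive real roots, and the complex powers $[\varepsilon_q^{j-1}g^{-1/q}x_j]^{-qa}$, $[\varepsilon_n^{j-1}\beta^{-1/n}x_j]^{-na}$ are principal (their bases are near $1$). Notation: ${}_nF_{n-1}(a_1,\dots,a_n;b_1,\dots,b_{n-1};\zeta)=\sum_{k\ge0}\frac{(a_1)_k\cdots(a_n)_k}{(b_1)_k\cdots(b_{n-1})_k(1)_k}\zeta^k$. For $c\in\mathbb{C}$, $(c)_r=c(c+1)\cdots(c+r-1)$ for $r\ge0$ and $(c)_{-s}=[(c-s)\cdots(c-1)]^{-1}$ for $s\ge0$; $\binom{c}{r}=(c-r+1)_r/r!$. Rational functions $F_\ell$: for $\ell\in\mathbb{Z}$ and $B\ne0,1$ let $f_\ell(A,B;k)=\frac{(A+Bk+1)_{\ell-1}}{(A+1)_{\ell-1}}$ and $\hat f_\ell(A,B;r)=\sum_{k=0}^r(-1)^k\binom{r}{k}\binom{A+Bk}{r}f_\ell(A,B;k)$. Then $F_\ell(A,B;y)$ is the rational function of $y$ given near $y=1$ by $F_\ell(A,B;y)=\sum_{r\ge0}\hat f_\ell(A,B;r)\left(\frac{1-y}{y}\right)^r$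 (this series is known to be the expansion of a rational function). E.g. $F_0\equiv1$, $F_1(A,B;y)=\frac{y}{(1-B)y+B}$. *)

(* Defs.v *)
From HB Require Import structures.
From mathcomp Require Import all_boot all_order all_algebra.
From mathcomp Require Import all_classical all_reals all_analysis.
From mathcomp Require Import complex.

Set Implicit Arguments.
Unset Strict Implicit.
Unset Printing Implicit Defensive.

Import Order.TTheory GRing.Theory Num.Theory.
Import numFieldNormedType.Exports.

Local Open Scope classical_set_scope.
Local Open Scope ring_scope.
Local Open Scope complex_scope.

(* The topology of the complex numbers is the norm topology, which the library
   attaches to [R[i]^o]. *)
Definition has_sum (R : realType) (u : nat -> R[i]) (s : R[i]) : Prop :=
  series (u : nat -> R[i]^o) @ \oo --> (s : R[i]^o).

Definition csummable (R : realType) (u : nat -> R[i]) : Prop :=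
  cvgn (series (u : nat -> R[i]^o)).

Definition csum (R : realType) (u : nat -> R[i]) : R[i] :=
  limn (series (u : nat -> R[i]^o)).

Definition cexp (R : realType) (z : R[i]) : R[i] :=
  (expR (complex.Re z))%:C * (cos (complex.Im z) +i* sin (complex.Im z)).

Definition cabs (R : realType) (z : R[i]) : R := complex.Re `|z|.

(* Principal argument, in ]-pi, pi], of a nonzero complex number. *)
Definition carg (R : realType) (z : R[i]) : R :=
  let t := acos (complex.Re z / cabs z) in
  if 0 <= complex.Im z then t else - t.

Definition clog (R : realType) (z : R[i]) : R[i] := ln (cabs z) +i* carg z.

(* Principal power; only meaningful for [z != 0]. *)
Definition cpow (R : realType) (z w : R[i]) : R[i] := cexp (w * clog z).

Definition eps (R : realType) (r : nat) : R[i] := cexp (0 +i* (2 * pi / r%:R)).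

(* [(c)_r]; note that [Negz s] is [- s.+1]. *)
Definition poch (R : realType) (c : R[i]) (r : int) : R[i] :=
  match r with
  | Posz m => \prod_(0 <= i < m) (c + i%:R)
  | Negz s => (\prod_(1 <= i < s.+2) (c - i%:R))^-1
  end.

(* No division by zero occurs in [(c)_r]. *)
Definition poch_defined (R : realType) (c : R[i]) (r : int) : Prop :=
  match r with
  | Posz _ => True
  | Negz s => \prod_(1 <= i < s.+2) (c - i%:R) != 0
  end.

Definition cbin (R : realType) (c : R[i]) (r : nat) : R[i] :=
  poch (c - r%:R + 1) r / r`!%:R.

Definition nonpos_int (R : realType) (b : R[i]) : Prop :=
  exists m : nat, b = - m%:R.

Definition hyp_term (R : realType) (us bs : seq R[i]) (z : R[i]) (k : nat) :
    R[i] :=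
  (\prod_(u <- us) poch u k) / ((\prod_(b <- bs) poch b k) * poch 1 k) * z ^+ k.

(* Generalized hypergeometric function with upper parameters [us] and lower
   parameters [bs], the factor [(1)_k] being implicit. *)
Definition hypF (R : realType) (us bs : seq R[i]) (z : R[i]) : R[i] :=
  csum (hyp_term us bs z).

Definition f_coef (R : realType) (ell : int) (A B : R[i]) (k : nat) : R[i] :=
  poch (A + B * k%:R + 1) (ell - 1) / poch (A + 1) (ell - 1).

(* No division by zero occurs in any [f_coef ell A B k]. *)
Definition f_defined (R : realType) (ell : int) (A B : R[i]) : Prop :=
  [/\ poch_defined (A + 1) (ell - 1),
      poch (A + 1) (ell - 1) != 0 &
      forall k : nat, poch_defined (A + B * k%:R + 1) (ell - 1)].

Definition f_hat (R : realType) (ell : int) (A B : R[i]) (r : nat) : R[i] :=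
  \sum_(0 <= k < r.+1)
    (-1) ^+ k * 'C(r, k)%:R * cbin (A + B * k%:R) r * f_coef ell A B k.

(* The reduced fraction [N / D] has the defining expansion of F_ell near 1. *)
Definition is_F_ratfun (R : realType) (ell : int) (A B : R[i])
    (F : {poly R[i]} * {poly R[i]}) : Prop :=
  let: (N, D) := F in
  coprimep N D /\
  exists2 d : R, 0 < d &
    forall y : R[i], `|y - 1| < d%:C ->
      D.[y] != 0 /\
      has_sum (fun r => f_hat ell A B r * ((1 - y) / y) ^+ r) (N.[y] / D.[y]).

(* Value at [y] of the rational function; a reduced fraction is unique up to a
   common scalar factor, so the choice of [F] is immaterial. *)
Definition F_rat (R : realType) (ell : int) (A B : R[i]) (y : R[i]) : R[i] :=
  let F := xget (0, 1) [set F | is_F_ratfun ell A B F] in F.1.[y] / F.2.[y].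

Definition upper_zero (R : realType) (p q : nat) (a : R[i]) (kappa : nat) :
    seq R[i] :=
  [seq (a + i%:R) / (p + q)%:R + kappa%:R / q%:R | i <- iota 0 (p + q)].

Definition lower_zero (R : realType) (p q : nat) (ell : int) (a : R[i])
    (kappa : nat) : seq R[i] :=
  [seq (a - ell%:~R + i%:R) / p%:R + kappa%:R / q%:R | i <- iota 1 p]
  ++ [seq i%:R / q%:R + kappa%:R / q%:R
       | i <- [seq i <- iota 1 q | i != (q - kappa)%N]].

Definition upper_infty (R : realType) (p q : nat) (ell : int) (a : R[i])
    (kappa : nat) : seq R[i] :=
  [seq (- a + ell%:~R + i%:R) / p%:R + kappa%:R / (p + q)%:R | i <- iota 0 p]
  ++ [seq (a + i%:R) / q%:R + kappa%:R / (p + q)%:R | i <- iota 0 q].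

Definition lower_infty (R : realType) (p q : nat) (kappa : nat) : seq R[i] :=
  [seq i%:R / (p + q)%:R + kappa%:R / (p + q)%:R
    | i <- [seq i <- iota 1 (p + q) | i != (p + q - kappa)%N]].

Definition trinomial_root (R : realType) (p q : nat) (g beta x : R[i]) : Prop :=
  x ^+ (p + q) - g * x ^+ p - beta = 0.

Definition root_near (R : realType) (p q : nat) (g beta c : R[i]) (rho : R)
    (x : R[i]) : Prop :=
  `|x - c| < rho%:C /\ trinomial_root p q g beta x.

(* Main.v *)
(** Put [y = u^N] with [u] near 1, [w = (1 - y) / y], and [t = (y - 1) y^(-B)].
  Since [y^(-A) t^k = (-w)^k (1 + w)^(A + B k - k)], expanding by the binomial
  series and summing the double series along antidiagonals turns
  [y^(-A) sum_k C(A + B k, k) f(k) t^k] into [sum_r fhat(r) w^r], which is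
  [F_ell (A, B; y)].  The trinomial equation rescales to [u^n - u^p = om^j t]
  ([N = q], [B = - p / q]) or [u^n - om^j t u^p = 1] ([N = n], [B = p / n]) with
  [om] a primitive [N]-th root of unity, so averaging over the [N] roots keeps
  the terms with [k = kappa] mod [N]; their ratios are those of the
  hypergeometric series by the multiplication formula for Pochhammer symbols. *)
Require Import Defs.
From HB Require Import structures.
From mathcomp Require Import all_boot all_order all_algebra.
From mathcomp Require Import all_classical all_reals all_analysis.
From mathcomp Require Import complex ring lra zify.

Set Implicit Arguments.
Unset Strict Implicit.
Unset Printing Implicit Defensive.

Import Order.TTheory GRing.Theory Num.Theory.
Import numFieldNormedType.Exports.
Local Open Scope classical_set_scope.
Local Open Scope ring_scope.
Local Open Scope complex_scope.

(** * Complex moduli and convergent series *)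

(** Two facts carry most of the work. The first is that the binomial series with complex exponent
    sums to the principal power. By Vandermonde the sum is multiplicative in the exponent [c], and
    it is [1 + c L + O(c^2)] for small [c]; these two properties force it to be [cexp (c * L)]. Then
    [L] and [- N log u] have the same exponential, and both are too small to differ by a period. The
    second is that the series defining [F_rat] sums to a rational function. For the weight 1 the
    transform is [(- B)^r], with generating function [1 / (1 + B w)]. Multiplying the weight by a
    factor affine in [k] acts on generating functions by operators that keep only powers of
    [1 + B w] in the denominator. For a Pochhammer symbol of negative order, the weight cancels
    factors of the binomial coefficient, and finite differences of low-degree polynomials vanish, so
    the series terminates. Coefficients are only required to grow at most geometrically, so that
    closeness of [y] to 1 yields absolute convergence and one Fubini lemma justifies every
    rearrangement. Coprimality of [p] and [q] makes the relevant power of [eps] a primitive root. *)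

Lemma cabsE (R : realType) (z : R[i]) : `|z| = (cabs z)%:C.
Proof. by rewrite /cabs RRe_real // normr_real. Qed.

Lemma cabs_def (R : realType) (z : R[i]) :
  cabs z = Num.sqrt (complex.Re z ^+ 2 + complex.Im z ^+ 2).
Proof. by rewrite /cabs normc_def. Qed.

Lemma cabs_ge0 (R : realType) (z : R[i]) : 0 <= cabs z.
Proof. by rewrite cabs_def sqrtr_ge0. Qed.

Lemma cabsM (R : realType) (y z : R[i]) : cabs (y * z) = cabs y * cabs z.
Proof. by apply: complexI; rewrite rmorphM /= -!cabsE normrM. Qed.

Lemma cabs_eq0 (R : realType) (z : R[i]) : (cabs z == 0) = (z == 0).
Proof. by rewrite -[RHS]normr_eq0 cabsE -(inj_eq (@complexI R)). Qed.

Lemma cabs_gt0 (R : realType) (z : R[i]) : (0 < cabs z) = (z != 0).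
Proof. by rewrite lt_neqAle cabs_ge0 andbT eq_sym cabs_eq0. Qed.

Lemma cabsV (R : realType) (z : R[i]) : cabs z^-1 = (cabs z)^-1.
Proof. by apply: complexI; rewrite fmorphV /= -!cabsE normfV. Qed.

Lemma cabsX (R : realType) (z : R[i]) k : cabs (z ^+ k) = cabs z ^+ k.
Proof. by apply: complexI; rewrite rmorphXn /= -!cabsE normrX. Qed.

Lemma cabs_real (R : realType) (x : R) : cabs x%:C = `|x|.
Proof. by rewrite cabs_def /= expr0n addr0 sqrtr_sqr. Qed.

Lemma natrC (R : realType) k : k%:R = (k%:R : R)%:C.
Proof. by rewrite (rmorph_nat (real_complex R)). Qed.

Lemma cabs_nat (R : realType) k : cabs (k%:R : R[i]) = k%:R.
Proof. by rewrite natrC cabs_real normr_nat. Qed.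

Lemma cabs0 (R : realType) : cabs (0 : R[i]) = 0.
Proof. by apply/eqP; rewrite cabs_eq0. Qed.

Lemma cabs1 (R : realType) : cabs (1 : R[i]) = 1.
Proof. exact: (cabs_nat R 1). Qed.

Lemma cabsN (R : realType) (z : R[i]) : cabs (- z) = cabs z.
Proof. by apply: complexI; rewrite -!cabsE normrN. Qed.

Lemma cabsBC (R : realType) (y z : R[i]) : cabs (y - z) = cabs (z - y).
Proof. by rewrite -cabsN opprB. Qed.

Lemma ler_cabsD (R : realType) (y z : R[i]) : cabs (y + z) <= cabs y + cabs z.
Proof. by rewrite -lecR rmorphD /= -!cabsE ler_normD. Qed.

Lemma ler_cabsB (R : realType) (y z : R[i]) : cabs (y - z) <= cabs y + cabs z.
Proof. by rewrite -(cabsN z) ler_cabsD. Qed.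

Lemma lerB_cabs (R : realType) (y z : R[i]) : cabs y - cabs z <= cabs (y - z).
Proof. by rewrite lerBlDr; have := ler_cabsD (y - z) z; rewrite subrK. Qed.

Lemma ler_cabs_sum (R : realType) (I : Type) (r : seq I) (P : pred I)
    (F : I -> R[i]) :
  cabs (\sum_(i <- r | P i) F i) <= \sum_(i <- r | P i) cabs (F i).
Proof.
elim/big_ind2 : _ => //; first by rewrite cabs0.
by move=> x y z t xy zt; apply: le_trans (ler_cabsD _ _) (lerD xy zt).
Qed.

Lemma cabs_prod (R : realType) (I : Type) (r : seq I) (P : pred I)
    (F : I -> R[i]) :
  cabs (\prod_(i <- r | P i) F i) = \prod_(i <- r | P i) cabs (F i).
Proof. by apply: (big_morph (@cabs R) (@cabsM R)); rewrite cabs1. Qed.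

Lemma ltc_cabs (R : realType) (z : R[i]) (d : R) :
  (`|z| < d%:C) = (cabs z < d).
Proof. by rewrite cabsE ltcR. Qed.

Lemma ler_Re_cabs (R : realType) (z : R[i]) : `|complex.Re z| <= cabs z.
Proof. by rewrite -lecR -cabsE normc_ge_Re. Qed.

Lemma ler_Im_cabs (R : realType) (z : R[i]) : `|complex.Im z| <= cabs z.
Proof.
by rewrite -(sqrtr_sqr (complex.Im z)) cabs_def ler_wsqrtr// lerDr sqr_ge0.
Qed.

Lemma ler_cabs_ReIm (R : realType) (z : R[i]) :
  cabs z <= `|complex.Re z| + `|complex.Im z|.
Proof.
rewrite cabs_def -[leRHS]ger0_norm ?addr_ge0// -sqrtr_sqr ler_wsqrtr//.
rewrite -(real_normK (num_real (complex.Re z))).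
rewrite -(real_normK (num_real (complex.Im z))).
have := normr_ge0 (complex.Re z); have := normr_ge0 (complex.Im z); nra.
Qed.

(** Moves convergence from the norm topology of [R[i]^o] to a real sequence, so that squeeze
    arguments over the reals apply. *)
Lemma has_sumP (R : realType) (u : nat -> R[i]) (s : R[i]) :
  has_sum u s <->
  (fun n => cabs (\sum_(0 <= k < n) u k - s)) @ \oo --> (0 : R).
Proof.
rewrite /has_sum; split => [/cvgrPdist_lt h | /cvgrPdist_lt h];
  apply/cvgrPdist_lt => e e0.
- have /h : 0 < e%:C by rewrite ltcR.
  apply: filterS => n; rewrite /series/= cabsE ltcR cabsBC => lt.
  by rewrite sub0r normrN ger0_norm ?cabs_ge0.
- have [er e0'] : e = (complex.Re e)%:C /\ 0 < complex.Re e.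
    have er : e = (complex.Re e)%:C by rewrite RRe_real ?gtr0_real.
    by split=> //; rewrite -ltcR -er.
  have /h := e0'; apply: filterS => n.
  rewrite sub0r normrN ger0_norm ?cabs_ge0// => lt.
  by rewrite /series/= er cabsE ltcR cabsBC.
Qed.

Lemma cvg0_le (R : realType) (u v : nat -> R) : v @ \oo --> (0 : R) ->
  (forall n, 0 <= u n <= v n) -> u @ \oo --> (0 : R).
Proof.
move=> v0 uv; apply: (@squeeze_cvgr _ _ _ _ (fun=> 0) v) => //.
  by near=> n; exact: uv.
exact: cvg_cst.
Unshelve. all: by end_near. Qed.

Lemma has_sum_unique (R : realType) (u : nat -> R[i]) (s t : R[i]) :
  has_sum u s -> has_sum u t -> s = t.
Proof. by move=> us ut; apply: cvg_unique us ut. Qed.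

Lemma has_sum_eq (R : realType) (u v : nat -> R[i]) (s : R[i]) :
  has_sum u s -> u =1 v -> has_sum v s.
Proof. by move=> us /funext <-. Qed.

Lemma has_sum_csum (R : realType) (u : nat -> R[i]) (s : R[i]) :
  has_sum u s -> csum u = s.
Proof. by move=> us; apply: cvg_lim us. Qed.

Lemma has_sum_csummable (R : realType) (u : nat -> R[i]) (s : R[i]) :
  has_sum u s -> csummable u.
Proof. by move=> us; apply: cvgP us. Qed.

#[local] Opaque has_sum.

Lemma has_sumD (R : realType) (u v : nat -> R[i]) (s t : R[i]) :
  has_sum u s -> has_sum v t -> has_sum (fun k => u k + v k) (s + t).
Proof.
move=> /has_sumP us /has_sumP vt; apply/has_sumP.
have cv := cvgD us vt; rewrite addr0 in cv.
apply: (cvg0_le (cv _)) => n; rewrite cabs_ge0/=.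
by rewrite big_split /= opprD addrACA ler_cabsD.
Qed.

Lemma has_sumZ (R : realType) (u : nat -> R[i]) (c s : R[i]) :
  has_sum u s -> has_sum (fun k => c * u k) (c * s).
Proof.
move=> /has_sumP us; apply/has_sumP.
have cv := cvgMl_tmp (a := cabs c) us; rewrite mulr0 in cv.
apply: (cvg0_le (cv _)) => n.
by rewrite cabs_ge0/= -big_distrr/= -mulrBr cabsM.
Qed.

Lemma has_sum_zero (R : realType) : has_sum (fun _ : nat => 0 : R[i]) 0.
Proof.
apply/has_sumP; apply: (@cvg0_le _ _ (fun=> 0)); first exact: cvg_cst.
by move=> n; rewrite big1// subrr cabs0 lexx.
Qed.

Lemma has_sum_bigsum (R : realType) (I : Type) (r : seq I)
    (u : I -> nat -> R[i]) (s : I -> R[i]) :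
  (forall i, has_sum (u i) (s i)) ->
  has_sum (fun k => \sum_(i <- r) u i k) (\sum_(i <- r) s i).
Proof.
move=> us; elim: r => [|i r IH].
  rewrite big_nil; refine (has_sum_eq (@has_sum_zero R) _) => k.
  by rewrite big_nil.
rewrite big_cons; refine (has_sum_eq (has_sumD (us i) IH) _) => k.
by rewrite big_cons.
Qed.

Lemma has_sum_finite (R : realType) (u : nat -> R[i]) (m : nat) :
  (forall k, (m <= k)%N -> u k = 0) -> has_sum u (\sum_(0 <= k < m) u k).
Proof.
move=> u0; apply/has_sumP; apply/cvgrPdist_lt => e e0; near=> n.
rewrite (@big_cat_nat _ _ _ m 0%N n) //=; last by near: n; exact: nbhs_infty_ge.
rewrite addrAC subrr add0r big_nat_cond big1 ?sub0r.
  by rewrite addr0 cabs0 oppr0 normr0.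
by move=> k /andP[/andP[/u0]].
Unshelve. all: by end_near. Qed.

Lemma has_sum_shift (R : realType) (u : nat -> R[i]) (s : R[i]) :
  has_sum u s -> has_sum (fun k => if k is k'.+1 then u k' else 0) s.
Proof.
move=> /has_sumP us; apply/has_sumP; rewrite -(cvg_shiftS _ (nbhs (0 : R))) /=.
apply: cvg_trans us; apply: near_eq_cvg; near=> n.
by rewrite big_nat_recl//= add0r.
Unshelve. all: by end_near. Qed.

Lemma has_sum_ReIm (R : realType) (u : nat -> R[i]) (x y : R) :
  series (fun k => complex.Re (u k)) @ \oo --> x ->
  series (fun k => complex.Im (u k)) @ \oo --> y ->
  has_sum u (x +i* y).
Proof.
move=> hx hy; apply/has_sumP.
have sx : (fun n => series (fun k => complex.Re (u k)) n - x) @ \oo --> (0 : R).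
  by rewrite -(subrr x); apply: cvgB => //; exact: cvg_cst.
have sy : (fun n => series (fun k => complex.Im (u k)) n - y) @ \oo --> (0 : R).
  by rewrite -(subrr y); apply: cvgB => //; exact: cvg_cst.
have cv := cvgD (cvg_norm sx) (cvg_norm sy); rewrite normr0 addr0 in cv.
apply: (cvg0_le (cv _ _ _)) => n; rewrite cabs_ge0/=; apply: le_trans (ler_cabs_ReIm _) _.
by rewrite raddfB/= raddfB/= !raddf_sum.
Qed.

Lemma geometric_has_sum (R : realType) (u : nat -> R[i]) (C rho : R) :
  0 <= rho < 1 -> (forall k, cabs (u k) <= C * rho ^+ k) ->
  exists s, has_sum u s.
Proof.
move=> /andP[rho0 rho1] hu.
have gs : cvgn (series (geometric C rho)).
  by apply: is_cvg_geometric_series; rewrite ger0_norm.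
have aux (v : nat -> R) : (forall k, `|v k| <= cabs (u k)) -> cvgn (series v).
  move=> vu; apply: normed_cvg; apply: series_le_cvg gs => //.
  - by move=> k; exact: normr_ge0.
  - by move=> k; exact: le_trans (cabs_ge0 _) (hu k).
  - by move=> k; apply: le_trans (vu k) (hu k).
have hx := aux _ (fun k => ler_Re_cabs (u k)).
have hy := aux _ (fun k => ler_Im_cabs (u k)).
eexists; exact: has_sum_ReIm hx hy.
Qed.

Lemma has_sum_le (R : realType) (u : nat -> R[i]) (s : R[i]) (c : R) :
  has_sum u s -> (forall n, cabs (\sum_(0 <= k < n) u k) <= c) -> cabs s <= c.
Proof.
move=> /has_sumP us hu; rewrite -subr_le0.
apply: cvgr_to_ge us _; near=> n.
rewrite cabsBC; apply: le_trans (lerB_cabs _ _); exact: lerB.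
Unshelve. all: by end_near. Qed.

Lemma has_sum_drop (R : realType) (u : nat -> R[i]) (s : R[i]) (m : nat) :
  has_sum u s ->
  has_sum (fun k => u (m + k)%N) (s - \sum_(0 <= k < m) u k).
Proof.
move=> us; elim: m => [|m IH].
  by rewrite (big_geq (leqnn 0)) subr0; exact: us.
move: IH => /has_sumP IH; apply/has_sumP.
rewrite -(cvg_shiftS _ (nbhs (0 : R))) /= in IH.
apply: cvg_trans IH; apply: near_eq_cvg; near=> n.
rewrite big_nat_recl//= big_nat_recr//= addn0; congr cabs.
under eq_bigr do rewrite addnS.
under [in RHS]eq_bigr do rewrite addSn.
by rewrite !opprD !opprK; ring.
Unshelve. all: by end_near. Qed.

Lemma geometric_sum_le (R : realType) (rho : R) n : 0 <= rho < 1 ->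
  \sum_(0 <= k < n) rho ^+ k <= (1 - rho)^-1.
Proof.
move=> /andP[rho0 rho1]; have r1 : 0 < 1 - rho by rewrite subr_gt0.
rewrite -[leRHS]mul1r ler_pdivlMr// big_mkord mulrC -opprB mulNr -subrX1 opprB.
by rewrite gerBl exprn_ge0.
Qed.

Lemma geometric_tail (R : realType) (u : nat -> R[i]) (C rho : R) s n :
  0 <= rho < 1 -> (forall k, cabs (u k) <= C * rho ^+ k) -> has_sum u s ->
  cabs (s - \sum_(0 <= k < n) u k) <= C * rho ^+ n / (1 - rho).
Proof.
move=> hr hu us; have /andP[rho0 _] := hr.
have C0 : 0 <= C by have := hu 0%N; rewrite expr0 mulr1; apply/le_trans/cabs_ge0.
apply: (has_sum_le (has_sum_drop (m := n) us)) => m.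
apply: le_trans (ler_cabs_sum _ _ _) _.
apply: (@le_trans _ _ (\sum_(0 <= k < m) C * rho ^+ n * rho ^+ k)).
  by apply: ler_sum => k _; rewrite -mulrA -exprD; exact: hu.
rewrite -big_distrr/=; apply: ler_wpM2l; last exact: geometric_sum_le.
by rewrite mulr_ge0 ?exprn_ge0.
Qed.

(** With [sg] the square root of [rho], the number [n sg^n] is at most the sum of the first [n]
    powers of [sg], hence bounded; the remaining factor [sg^n] tends to 0. *)
Lemma cvg_natmul_expr (R : realType) (rho : R) : 0 <= rho < 1 ->
  (fun n => n%:R * rho ^+ n) @ \oo --> (0 : R).
Proof.
move=> /andP[rho0 rho1]; set sg := Num.sqrt rho.
have sg0 : 0 <= sg by rewrite sqrtr_ge0.
have sg1 : sg < 1 by rewrite -[ltRHS]sqrtr1 ltr_sqrt.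
have sgE : sg ^+ 2 = rho by rewrite sqr_sqrtr.
have bnd n : n%:R * sg ^+ n <= (1 - sg)^-1.
  apply: le_trans (@geometric_sum_le _ sg n _); last by rewrite sg0 sg1.
  rewrite mulr_natl -[X in _ *+ X]subn0 -sumr_const_nat.
  rewrite !big_nat; apply: ler_sum => k /andP[_ kn].
  by apply: ler_wiXn2l; [|exact: ltW|exact: ltnW].
have cv : geometric 1 sg @ \oo --> 0.
  by apply: cvg_geometric; rewrite ger0_norm.
have cv' := cvgMl_tmp (a := (1 - sg)^-1) cv; rewrite mulr0 in cv'.
apply: (cvg0_le (cv' _)) => n; apply/andP; split.
  by rewrite mulr_ge0// exprn_ge0.
rewrite /geometric/= mul1r -sgE -exprM mulnC exprM expr2 mulrA.
by apply: ler_wpM2r; rewrite ?exprn_ge0.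
Qed.

Lemma sum_triangle (R : realType) (a : nat -> nat -> R[i]) n :
  \sum_(0 <= r < n) \sum_(0 <= k < r.+1) a k (r - k)%N =
  \sum_(0 <= k < n) \sum_(0 <= m < n - k) a k m.
Proof.
elim: n => [|n IH]; first by rewrite !big_geq.
rewrite big_nat_recr//= IH [in RHS]big_nat_recr//= subSnn big_nat1.
rewrite [X in _ + X]big_nat_recr//= subnn addrA; congr (_ + _).
rewrite -big_split/= [in RHS]big_nat [in LHS]big_nat; apply: eq_bigr => k /andP[_ kn].
by rewrite subSn ?(ltnW kn)// big_nat_recr.
Qed.

(* Fubini for a geometrically dominated double series: summing by rows or by
   antidiagonals gives the same value. *)
Lemma has_sum_antidiagonal (R : realType) (a : nat -> nat -> R[i])
    (b : nat -> R[i]) (C rho : R) :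
  0 <= rho < 1 -> (forall k m, cabs (a k m) <= C * rho ^+ (k + m)) ->
  (forall k, has_sum (a k) (b k)) ->
  exists2 S, has_sum b S &
    has_sum (fun r => \sum_(0 <= k < r.+1) a k (r - k)%N) S.
Proof.
move=> hr ha hb; have /andP[rho0 rho1] := hr.
have r1 : 0 < 1 - rho by rewrite subr_gt0.
have ha' k m : cabs (a k m) <= C * rho ^+ k * rho ^+ m.
  by rewrite -mulrA -exprD.
have tl k n := geometric_tail n hr (ha' k) (hb k).
have [|S bS] := @geometric_has_sum _ b (C / (1 - rho)) rho hr.
  move=> k; have := tl k 0%N; rewrite big_geq// subr0 expr0 mulr1.
  by rewrite mulrAC.
exists S => //; apply/has_sumP.
have /has_sumP bS' := bS.
(* Inside the triangle, row [k] is cut at [n - k], and its tail is at most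
   [C rho^k rho^(n - k) / (1 - rho)]. This does not depend on [k], so the [n] rows together lose at
   most a multiple of [n rho^n]. *)
have cv := cvgMl_tmp (a := C / (1 - rho)) (cvg_natmul_expr hr).
have cv' := cvgD bS' (cv _); rewrite mulr0 addr0 in cv'.
apply: (cvg0_le (cv' _ _)) => n; rewrite cabs_ge0/=.
rewrite sum_triangle -[X in X - S](subrK (\sum_(0 <= k < n) b k)) -addrA.
apply: le_trans (ler_cabsD _ _) _; rewrite [leLHS]addrC; apply: lerD => //.
rewrite cabsBC -sumrB.
apply: le_trans (ler_cabs_sum _ _ _) _.
apply: (@le_trans _ _ (\sum_(0 <= k < n) (C / (1 - rho) * rho ^+ n))).
  rewrite !big_nat; apply: ler_sum => k /andP[_ kn].
  apply: le_trans (tl k (n - k)%N) _.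
  by rewrite -(mulrA C) -exprD subnKC ?(ltnW kn)// mulrAC.
by rewrite sumr_const_nat subn0 -[leLHS]mulr_natl mulrCA.
Qed.

(** * Complex exponential, logarithm and powers *)

Lemma cexpD (R : realType) (y z : R[i]) : cexp (y + z) = cexp y * cexp z.
Proof.
case: y z => [a b] [c d]; rewrite /cexp /= expRD cosD sinD; simpc.
by apply/eqP; rewrite eq_complex /=; apply/andP; split; apply/eqP; ring.
Qed.

Lemma cexp0 (R : realType) : cexp (0 : R[i]) = 1.
Proof. by rewrite /cexp /= expR0 cos0 sin0 mul1r. Qed.

Lemma cexpMn (R : realType) n (z : R[i]) : cexp (n%:R * z) = cexp z ^+ n.
Proof.
elim: n => [|n IH]; first by rewrite mul0r cexp0 expr0.
by rewrite -natr1 mulrDl mul1r cexpD IH exprSr.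
Qed.

Lemma cexp_neq0 (R : realType) (z : R[i]) : cexp z != 0.
Proof.
apply/negP => /eqP z0; have := cexpD z (- z).
by rewrite subrr cexp0 z0 mul0r => /eqP; rewrite oner_eq0.
Qed.

Lemma cexpN (R : realType) (z : R[i]) : cexp (- z) = (cexp z)^-1.
Proof.
apply: (mulfI (cexp_neq0 z)); rewrite -cexpD subrr cexp0 divff//.
exact: cexp_neq0.
Qed.

Lemma cabs_cexp (R : realType) (z : R[i]) : cabs (cexp z) = expR (complex.Re z).
Proof.
rewrite /cexp cabsM cabs_real ger0_norm ?expR_ge0// cabs_def /=.
by rewrite cos2Dsin2 sqrtr1 mulr1.
Qed.

(** The bound 2, which is at most pi, keeps [|Im z|] in the interval where cosine is injective, so
    no nonzero period of the exponential can occur. *)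
Lemma cexp_eq1 (R : realType) (z : R[i]) :
  `|complex.Im z| < 2 -> cexp z = 1 -> z = 0.
Proof.
move=> zlt z1.
have x0 : complex.Re z = 0.
  by apply: expR_inj; rewrite -cabs_cexp z1 cabs1 expR0.
have : cos `|complex.Im z| = cos 0.
  move/(congr1 (@complex.Re R)): z1; rewrite /cexp x0 expR0 mul1r /=.
  by rewrite cos_norm cos0.
move/cos_inj; rewrite !in_itv/= normr_ge0 lexx pi_ge0 (le_trans (ltW zlt))//.
  move=> /(_ isT isT)/eqP; rewrite normr_eq0 => /eqP y0.
  by case: z x0 y0 {zlt z1} => a b /= -> ->.
exact: pi_ge2.
Qed.

Lemma cabs_ratio_itv (R : realType) (z : R[i]) :
  -1 <= complex.Re z / cabs z <= 1.
Proof.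
have [->|z0] := eqVneq z 0; first by rewrite cabs0 invr0 mulr0 lerN10 ler01.
have z1 : 0 < cabs z by rewrite cabs_gt0.
by rewrite -ler_norml normrM normfV (ger0_norm (ltW z1)) ler_pdivrMr// mul1r
  ler_Re_cabs.
Qed.

Lemma clogK (R : realType) (z : R[i]) : z != 0 -> cexp (clog z) = z.
Proof.
move=> z0; have z1 : 0 < cabs z by rewrite cabs_gt0.
have itv := cabs_ratio_itv z.
have cosE : cos (carg z) = complex.Re z / cabs z.
  by rewrite /carg; case: ifP => _; rewrite ?cosN acosK// in_itv.
have sinE : sin (carg z) = complex.Im z / cabs z.
  have sq : Num.sqrt (1 - (complex.Re z / cabs z) ^+ 2) =
      `|complex.Im z| / cabs z.
    suff -> : 1 - (complex.Re z / cabs z) ^+ 2 = (`|complex.Im z| / cabs z) ^+ 2.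
      by rewrite sqrtr_sqr ger0_norm// divr_ge0// ltW.
    have := cabs_def z => /(congr1 (fun x => x ^+ 2)).
    rewrite sqr_sqrtr ?addr_ge0 ?sqr_ge0// => zE.
    rewrite !expr_div_n real_normK ?num_real// -[1](@divff _ (cabs z ^+ 2)).
      by rewrite -mulrBl zE addrC addKr.
    by rewrite expf_neq0// gt_eqF.
  rewrite /carg; case: ifPn => [im0|]; rewrite ?sinN sin_acos// sq.
    by rewrite ger0_norm.
  by rewrite -ltNge => im0; rewrite ltr0_norm// mulNr opprK.
rewrite /cexp /clog /= cosE sinE lnK ?posrE//.
have mc x : cabs z * (x / cabs z) = x by rewrite mulrC divfK// gt_eqF.
by simpc; rewrite !mc; case: (z).
Qed.

Lemma cpowD (R : realType) (u b c : R[i]) : cpow u (b + c) = cpow u b * cpow u c.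
Proof. by rewrite /cpow mulrDl cexpD. Qed.

Lemma cpow_neq0 (R : realType) (u b : R[i]) : cpow u b != 0.
Proof. exact: cexp_neq0. Qed.

Lemma cpowN (R : realType) (u b : R[i]) : cpow u (- b) = (cpow u b)^-1.
Proof. by rewrite /cpow mulNr cexpN. Qed.

Lemma cpowMn (R : realType) (u b : R[i]) n : cpow u (n%:R * b) = cpow u b ^+ n.
Proof. by rewrite /cpow -mulrA cexpMn. Qed.

Lemma cpow_nat (R : realType) (u : R[i]) n : u != 0 -> cpow u n%:R = u ^+ n.
Proof. by move=> u0; rewrite /cpow cexpMn clogK. Qed.

Lemma norm_carg_lt (R : realType) (e : R) : 0 < e ->
  exists2 d : R, 0 < d & forall u : R[i], cabs (u - 1) < d -> `|carg u| < e.
Proof.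
move=> e0; pose e' := Num.min e (2^-1).
have e'0 : 0 < e' by rewrite lt_min e0 invr_gt0 ltr0n.
have e'1 : e' <= 2^-1 by rewrite ge_min lexx orbT.
have e'pi : e' < pi by have := pi_ge2 R; lra.
have k0 : 0 < cos e'.
  by apply: cos_gt0_pihalf; have := pihalf_ge1 R; move=> h; apply/andP; lra.
have k1 : cos e' < 1.
  by rewrite -[ltRHS](cos0 R) ltr_cos// in_itv/= ?lexx ?pi_ge0// !ltW.
(* Near 1 the cosine of the argument exceeds [(1 - d) / (1 + d)]. With [k = cos e'] this is more
   than [k], because [d (1 + k) < 4 d = 1 - k]. Capping [e'] at 1/2 makes [k] positive. *)
pose d := (1 - cos e') / 4; have d0 : 0 < d by rewrite /d; lra.
exists d => // u ud.
suff le : acos (complex.Re u / cabs u) < e.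
  have ge0 : 0 <= acos (complex.Re u / cabs u).
    exact: acos_ge0 (cabs_ratio_itv u).
  by rewrite /carg; case: ifP => _; rewrite ?normrN ger0_norm.
apply: (@lt_le_trans _ _ e'); last by rewrite ge_min lexx.
have re : 1 - d < complex.Re u.
  have := le_lt_trans (ler_Re_cabs (u - 1)) ud.
  by rewrite raddfB/= ltr_norml; lra.
have ab : cabs u < 1 + d.
  by have := ler_cabsD (u - 1) 1; rewrite subrK cabs1; lra.
have u0 : 0 < cabs u.
  have := ler_Re_cabs u; have := ler_norm (complex.Re u).
  by rewrite /d in re *; lra.
have itv := cabs_ratio_itv u.
have gt : cos e' < complex.Re u / cabs u.
  rewrite ltr_pdivlMr//; move: re ab; rewrite /d.
  set k := cos e' in k0 k1 *; set c := cabs u in u0 *; set r := complex.Re u.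
  move=> re ab.
  suff : k * c <= k * (1 + (1 - k) / 4).
    move=> h; apply: (le_lt_trans h); nra.
  by rewrite ler_pM2l// ltW.
rewrite -(ltr_cos (R := R)) ?acosK// in_itv/= ?acos_ge0 ?acos_lepi//.
by rewrite !ltW.
Qed.

(** The mean value theorem bounds sine, the half-angle formula then bounds [cos x - 1], and
    [sin x - x = x (cos c - 1)] for some intermediate [c]. Only the orders matter later, so the
    constants are crude. *)
Lemma sin_cos_bound (R : realType) (x : R) :
  [/\ `|sin x| <= `|x|, `|cos x - 1| <= x ^+ 2 & `|sin x - x| <= `|x| * x ^+ 2].
Proof.
have sinle (y : R) : 0 <= y -> `|sin y| <= y.
  move=> y0; have [|c _] := @MVT_segment R sin cos 0 y y0.
    by apply: continuous_subspaceT => z; exact: continuous_sin.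
  rewrite sin0 !subr0 => ->; rewrite normrM (ger0_norm y0).
  by rewrite ler_piMl// cos_max.
have sinle' (y : R) : `|sin y| <= `|y|.
  have [y0|/ltW y0] := lerP 0 y; first by rewrite (ger0_norm y0) sinle.
  by rewrite (ler0_norm y0) -normrN -sinN sinle// oppr_ge0.
have cosle (y : R) : `|cos y - 1| <= y ^+ 2.
  have -> : y = (y / 2) *+ 2 by rewrite -mulr_natr divfK.
  set t := y / 2; rewrite cos_mulr2n cos2sin2.
  have := sinle' t; have := normr_ge0 (sin t) => s0 st.
  have : sin t ^+ 2 <= t ^+ 2.
    rewrite -(real_normK (num_real (sin t))) -(real_normK (num_real t)).
    by rewrite lerXn2r ?nnegrE.
  have -> : (t *+ 2) ^+ 2 = 4 * t ^+ 2 by ring.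
  have := sqr_ge0 (sin t); move: (sin t ^+ 2) (t ^+ 2) => p r p0 h.
  by rewrite ler_norml; lra.
have sinx (y : R) : 0 <= y -> `|sin y - y| <= y * y ^+ 2.
  move=> y0; have [|c cy] := @MVT_segment R sin cos 0 y y0.
    by apply: continuous_subspaceT => z; exact: continuous_sin.
  rewrite sin0 !subr0 => ->; rewrite -[X in _ - X]mul1r -mulrBl normrM mulrC.
  rewrite (ger0_norm y0) ler_wpM2l//; apply: le_trans (cosle c) _.
  by move: cy; rewrite in_itv/= => /andP[c0 cy]; rewrite lerXn2r.
split=> //; case/orP: (le_total 0 x) => x0.
  by rewrite (ger0_norm x0) sinx.
have := sinx (- x); rewrite oppr_ge0 => /(_ x0).
by rewrite sinN -opprD normrN sqrrN (ler0_norm x0).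
Qed.

(** The tangent inequality at [- x] gives [expR x (1 - x) <= 1], and
    [1 / (1 - x) - 1 - x = x^2 / (1 - x)] is at most [2 x^2] for [x <= 1/2]. *)
Lemma expR_bound (R : realType) (x : R) : `|x| <= 2^-1 ->
  `|expR x - 1 - x| <= 2 * x ^+ 2.
Proof.
rewrite ler_norml => /andP[x1 x2].
have h1 := expR_ge1Dx x; have h2 := expR_ge1Dx (- x).
have h3 := expRxMexpNx_1 x; have h4 := expR_gt0 x.
rewrite ger0_norm; last by lra.
have h5 : expR x * (1 - x) <= 1 by rewrite -[leRHS]h3 ler_pM2l.
set e := expR x in h1 h3 h4 h5 *.
suff : (e - 1 - x - 2 * x ^+ 2) * (1 - x) <= 0.
  by rewrite pmulr_lle0; [lra|lra].
have : 0 <= x ^+ 2 by exact: sqr_ge0.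
nra.
Qed.

Lemma cexp_bound (R : realType) (z : R[i]) : cabs z <= 2^-1 ->
  cabs (cexp z - 1 - z) <= 10 * cabs z ^+ 2.
Proof.
move=> zr; have := ler_Re_cabs z; have := ler_Im_cabs z.
case: z zr => x y zr /= yr xr.
apply: le_trans (ler_cabs_ReIm _) _; rewrite /cexp; simpc => /=.
set r := cabs _ in zr yr xr *; have r0 : 0 <= r by exact: cabs_ge0.
have [s1 s2 s3] := sin_cos_bound y.
have e1 := expR_bound (le_trans xr zr).
have x2 : x ^+ 2 <= r ^+ 2.
  by rewrite -(real_normK (num_real x)) lerXn2r ?nnegrE.
have y2 : y ^+ 2 <= r ^+ 2.
  by rewrite -(real_normK (num_real y)) lerXn2r ?nnegrE.
have re : `|expR x * cos y - 1 - x| <= 5 * r ^+ 2.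
  have -> : expR x * cos y - 1 - x =
    (expR x - 1 - x) * cos y + (1 + x) * (cos y - 1) by ring.
  apply: le_trans (ler_normD _ _) _; rewrite !normrM.
  have -> : 5 * r ^+ 2 = 2 * r ^+ 2 * 1 + 3 * r ^+ 2 by ring.
  apply: lerD; first by apply: ler_pM => //; [lra|exact: cos_max].
  apply: ler_pM => //; last by lra.
  by have := ler_normD 1 x; rewrite normr1; lra.
have im : `|expR x * sin y - y| <= 5 * r ^+ 2.
  have -> : expR x * sin y - y =
    expR x * (sin y - y) + (expR x - 1) * y by ring.
  apply: le_trans (ler_normD _ _) _; rewrite !normrM.
  have -> : 5 * r ^+ 2 = 2 * (r ^+ 2) + (3 * r) * r by ring.
  have er : `|expR x - 1| <= 2 * r.
    have := ler_normD (expR x - 1 - x) x; rewrite subrK => h.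
    by nra.
  apply: lerD; last by apply: ler_pM => //; lra.
  apply: ler_pM => //.
    by have := ler_normD (expR x - 1) 1; rewrite subrK normr1; lra.
  by apply: le_trans s3 _; have := sqr_ge0 y; nra.
by rewrite ?addr0 ?subr0 ?oppr0 ?add0r; move: re im; lra.
Qed.

Lemma cabs_exprB_le (R : realType) (y z : R[i]) (m : R) n :
  1 <= m -> cabs y <= m -> cabs z <= m ->
  cabs (y ^+ n - z ^+ n) <= n%:R * m ^+ n * cabs (y - z).
Proof.
move=> m1 ym zm; have m0 : 0 <= m by exact: le_trans m1.
elim: n => [|n IH]; first by rewrite !expr0 subrr cabs0 !mul0r.
have -> : y ^+ n.+1 - z ^+ n.+1 = y * (y ^+ n - z ^+ n) + (y - z) * z ^+ n.
  by rewrite !exprS; ring.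
apply: le_trans (ler_cabsD _ _) _; rewrite !cabsM -natr1 !mulrDl mul1r.
have d0 := cabs_ge0 (y - z).
apply: lerD.
  apply: (@le_trans _ _ (m * (n%:R * m ^+ n * cabs (y - z)))).
    by apply: ler_pM => //; exact: cabs_ge0.
  by rewrite exprS le_eqVlt; apply/orP; left; apply/eqP; ring.
rewrite mulrC ler_wpM2r// cabsX (@le_trans _ _ (m ^+ n))//.
  by rewrite lerXn2r ?nnegrE ?cabs_ge0.
by rewrite exprS ler_peMl// exprn_ge0.
Qed.

Lemma eq0_le_div_nat (R : realType) (x y : R) m : 0 <= x ->
  (forall n, (m < n)%N -> x <= y / n%:R) -> x = 0.
Proof.
move=> x0 h; apply/eqP; rewrite eq_le x0 andbT leNgt; apply/negP => xgt.
pose n := (m + Num.bound (`|y| / x)).+1.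
have n0 : 0 < n%:R :> R by rewrite ltr0n.
have := h n; rewrite leq_addr => /(_ isT).
rewrite ler_pdivlMr// leNgt => /negP; apply.
apply: (le_lt_trans (ler_norm y)); rewrite mulrC -ltr_pdivrMr//.
apply: (lt_le_trans (archi_boundP _)); first by rewrite divr_ge0.
by rewrite ler_nat /n ltnW// ltnS leq_addl.
Qed.

(* [b c = b (c / n) ^ n] and [cexp (c L) = cexp (c L / n) ^ n], while the two
   bases differ by [O(1 / n^2)]. *)
Lemma cexp_of_first_order (R : realType) (b : R[i] -> R[i]) (L : R[i]) (K : R) :
  (forall c n, b (n%:R * c) = b c ^+ n) ->
  (forall c, cabs c <= 1 -> cabs (b c - 1 - c * L) <= K * cabs c ^+ 2) ->
  forall c, b c = cexp (c * L).
Proof.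
move=> bX bK c.
have K0 : 0 <= K.
  by have := bK 1; rewrite cabs1 expr1n mulr1 => h; exact: le_trans (cabs_ge0 _) (h (lexx _)).
set q := cabs c; set l := cabs (c * L).
have q0 : 0 <= q by exact: cabs_ge0.
have l0 : 0 <= l by exact: cabs_ge0.
(* The two bases at [c / n] differ by at most [D / n^2] and both have modulus at most [1 + M / n].
   Their [n]-th powers therefore differ by at most [n exp(M) D / n^2]. *)
pose D := K * q ^+ 2 + 10 * l ^+ 2; pose M := l + K * q ^+ 2 + 10 * l ^+ 2.
have D0 : 0 <= D by rewrite addr_ge0// mulr_ge0// sqr_ge0.
have DM : D <= M by rewrite /D /M; lra.
have M0 : 0 <= M by exact: le_trans DM.
apply/eqP; rewrite -subr_eq0 -cabs_eq0; apply/eqP.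
(* Beyond this threshold [|c / n| <= 1] and [|c L / n| <= 1/2], the ranges where the two first-order
   bounds hold. *)
apply: (@eq0_le_div_nat _ _ (expR M * D) (Num.bound (q + 2 * l))).
  exact: cabs_ge0.
move=> n ltn.
have nb : q + 2 * l < n%:R.
  apply: (lt_trans (archi_boundP _)); last by rewrite ltr_nat.
  by rewrite addr_ge0// mulr_ge0.
have n1 : 1 <= n%:R :> R by rewrite ler1n; case: n ltn nb.
have n0 : 0 < n%:R :> R by exact: lt_le_trans n1.
have nC0 : n%:R != 0 :> R[i] by rewrite pnatr_eq0 -lt0n -(ltr_nat R).
pose c' := c / n%:R.
have c'E : c = n%:R * c' by rewrite /c' mulrC divfK.
have q' : cabs c' = q / n%:R by rewrite cabsM cabsV cabs_nat.
have l' : cabs (c' * L) = l / n%:R.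
  by rewrite /c' mulrAC cabsM cabsV cabs_nat.
have h1 : cabs (b c' - 1 - c' * L) <= K * q ^+ 2 / n%:R ^+ 2.
  apply: le_trans (bK _ _) _; first by rewrite q' ler_pdivrMr// mul1r; lra.
  by rewrite q' expr_div_n mulrA.
have h2 : cabs (cexp (c' * L) - 1 - c' * L) <= 10 * l ^+ 2 / n%:R ^+ 2.
  apply: le_trans (cexp_bound _) _; first by rewrite l' ler_pdivrMr//; lra.
  by rewrite l' expr_div_n mulrA.
have n2 : (n%:R ^+ 2)^-1 <= n%:R^-1 :> R.
  by rewrite lef_pV2 ?posrE ?exprn_gt0// expr2 ler_peMl.
have base (x : R[i]) (s : R) : 0 <= s -> s + l <= M ->
    cabs (x - 1 - c' * L) <= s / n%:R ^+ 2 -> cabs x <= 1 + M / n%:R.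
  move=> s0 sM xs; rewrite -(subrK 1 x) -(subrK (c' * L) (x - 1)).
  apply: le_trans (ler_cabsD _ _) _; rewrite cabs1 addrC lerD2l.
  apply: le_trans (ler_cabsD _ _) _; rewrite l'.
  apply: (@le_trans _ _ ((s + l) / n%:R)).
    by rewrite mulrDl lerD2r (le_trans xs)// ler_wpM2l.
  by rewrite ler_wpM2r// invr_ge0 ltW.
have b1 : cabs (b c') <= 1 + M / n%:R.
  by apply: (base _ _ _ _ h1); rewrite /M ?mulr_ge0 ?sqr_ge0//;
     have := sqr_ge0 l; lra.
have b2 : cabs (cexp (c' * L)) <= 1 + M / n%:R.
  apply: (base _ _ _ _ h2); rewrite /M ?mulr_ge0 ?sqr_ge0//.
  by have := mulr_ge0 K0 (sqr_ge0 q); lra.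
have m1 : 1 <= 1 + M / n%:R by rewrite lerDl divr_ge0// ltW.
rewrite c'E bX -mulrA cexpMn.
apply: le_trans (cabs_exprB_le n m1 b1 b2) _.
have dd : cabs (b c' - cexp (c' * L)) <= D / n%:R ^+ 2.
  have -> : b c' - cexp (c' * L) =
      (b c' - 1 - c' * L) - (cexp (c' * L) - 1 - c' * L) by ring.
  by apply: le_trans (ler_cabsB _ _) _; rewrite /D mulrDl lerD.
have pe : (1 + M / n%:R) ^+ n <= expR M.
  rewrite -[M in leRHS](@divfK _ n%:R) ?gt_eqF// expRM_natr lerXn2r ?nnegrE//.
  - exact: le_trans m1.
  - exact: expR_ge1Dx.
apply: (@le_trans _ _ (n%:R * expR M * (D / n%:R ^+ 2))).
  apply: ler_pM => //; last by rewrite ler_pM2l.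
    by rewrite mulr_ge0// exprn_ge0// (le_trans _ m1).
  exact: cabs_ge0.
rewrite le_eqVlt; apply/orP; left; apply/eqP; field.
by rewrite gt_eqF.
Qed.

(** * The binomial series *)

Lemma poch_posE (R : realType) (c : R[i]) (m : nat) :
  poch c m%:Z = \prod_(0 <= i < m) (c + i%:R).
Proof. by []. Qed.

Lemma poch_recl (R : realType) (c : R[i]) (m : nat) :
  poch c m.+1%:Z = c * poch (c + 1) m%:Z.
Proof.
rewrite !poch_posE big_nat_recl// addr0; congr (_ * _).
by apply: eq_bigr => i _; rewrite -natr1 addrAC addrA.
Qed.

Lemma poch_recr (R : realType) (c : R[i]) (m : nat) :
  poch c m.+1%:Z = poch c m%:Z * (c + m%:R).
Proof. by rewrite !poch_posE big_nat_recr. Qed.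

Lemma cbin0 (R : realType) (c : R[i]) : cbin c 0 = 1.
Proof. by rewrite /cbin poch_posE big_geq// fact0 divr1. Qed.

Lemma cbinS (R : realType) (c : R[i]) m :
  m.+1%:R * cbin c m.+1 = (c - m%:R) * cbin c m.
Proof.
have -> : cbin c m.+1 = (c - m%:R) * poch (c - m%:R + 1) m / m.+1`!%:R.
  rewrite /cbin poch_recl; congr (_ * poch _ _ / _).
  - by rewrite -natr1; ring.
  - by rewrite -natr1; ring.
rewrite /cbin factS natrM invfM.
have m0 : m.+1%:R != 0 :> R[i] by rewrite pnatr_eq0.
have f0 : m`!%:R != 0 :> R[i] by rewrite pnatr_eq0 -lt0n fact_gt0.
by move: (m.+1%:R) (m`!%:R) m0 f0 => x y x0 y0; field; rewrite x0 y0.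
Qed.

Lemma bin_le_exp2 n m : ('C(n, m) <= 2 ^ n)%N.
Proof.
have [mn|nm] := leqP m n; last by rewrite bin_small.
rewrite -[2%N]/(1 + 1)%N expnDn (bigD1 (Ordinal (mn : m < n.+1)%N))//=.
by rewrite !exp1n !muln1 leq_addr.
Qed.

(** Since [|c - i| <= s + i], the recursion of [cbin] is dominated by that of [C(s + m, m)]. The
    explicit dependence on [s] matters: later the upper index grows linearly in [k]. *)
Lemma cabs_cbin_le (R : realType) (c : R[i]) (s m : nat) :
  cabs c <= s%:R -> cabs (cbin c m) <= 2 ^+ (s + m).
Proof.
move=> cs; apply: (@le_trans _ _ 'C(s + m, m)%:R); last first.
  by rewrite -natrX ler_nat bin_le_exp2.
elim: m => [|m IH]; first by rewrite cbin0 cabs1 bin0.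
rewrite -(@ler_pM2l _ m.+1%:R) ?ltr0n// -{1}(cabs_nat R) -cabsM cbinS cabsM.
rewrite -natrM addnS -mul_bin_diag /= natrM; apply: ler_pM => //; try exact: cabs_ge0.
apply: le_trans (ler_cabsB _ _) _; rewrite cabs_nat -addnS natrD lerD//.
by rewrite ler_nat.
Qed.

(** Write [m + 1 = i + (m + 1 - i)] in each term and apply [cbinS] to the matching factor; the two
    resulting coefficients [c - i] and [d - (m - i)] add up to [c + d - m]. *)
Lemma cbin_vandermonde (R : realType) (c d : R[i]) m :
  \sum_(0 <= i < m.+1) cbin c i * cbin d (m - i) = cbin (c + d) m.
Proof.
elim: m => [|m IH]; first by rewrite big_nat1 subnn !cbin0 mulr1.
have m0 : m.+1%:R != 0 :> R[i] by rewrite pnatr_eq0.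
apply: (mulfI m0); rewrite cbinS -IH !big_distrr/=.
have -> : \sum_(0 <= i < m.+2) m.+1%:R * (cbin c i * cbin d (m.+1 - i)) =
    \sum_(0 <= i < m.+2) (i%:R * cbin c i) * cbin d (m.+1 - i) +
    \sum_(0 <= i < m.+2) cbin c i * ((m.+1 - i)%:R * cbin d (m.+1 - i)).
  rewrite -big_split/= !big_nat; apply: eq_bigr => i /andP[_ im].
  by rewrite natrB//; ring.
rewrite [in X in X + _ = _]big_nat_recl//= mul0r mul0r add0r.
rewrite [in X in _ + X = _]big_nat_recr//= subnn mul0r mulr0 addr0.
rewrite -big_split/= !big_nat; apply: eq_bigr => i /andP[_ im].
rewrite cbinS subSS subSn// cbinS natrB//; ring.
Qed.

Definition binser (R : realType) (w c : R[i]) : R[i] :=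
  csum (fun m => cbin c m * w ^+ m).

(** The radius 1/4 beats the growth [2^m] of the coefficients and leaves the ratio 1/2. *)
Lemma cabs_cbin_exp_le (R : realType) (w c : R[i]) s m :
  cabs w <= 4^-1 -> cabs c <= s%:R ->
  cabs (cbin c m * w ^+ m) <= 2 ^+ s * 2^-1 ^+ m.
Proof.
move=> w4 cs; rewrite cabsM cabsX.
apply: (@le_trans _ _ (2 ^+ (s + m) * 4^-1 ^+ m)).
  apply: ler_pM; rewrite ?exprn_ge0 ?cabs_ge0 ?cabs_cbin_le//.
  by rewrite lerXn2r ?nnegrE ?cabs_ge0.
rewrite exprD -mulrA -exprMn; have -> : 2 * 4^-1 = 2^-1 :> R by field.
by [].
Qed.

Lemma nat_bound (R : realType) (x : R) : exists s : nat, x <= s%:R.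
Proof.
exists (Num.bound `|x|); apply: le_trans (ler_norm x) (ltW (archi_boundP _)).
exact: normr_ge0.
Qed.

Lemma binser_has_sum (R : realType) (w c : R[i]) : cabs w <= 4^-1 ->
  has_sum (fun m => cbin c m * w ^+ m) (binser w c).
Proof.
move=> w4; have [s cs] := nat_bound (cabs c).
have [|S hS] := @geometric_has_sum R (fun m => cbin c m * w ^+ m)
    (2 ^+ s) 2^-1 _ (fun m => cabs_cbin_exp_le m w4 cs).
  by lra.
by rewrite /binser (has_sum_csum hS).
Qed.

Lemma binserD (R : realType) (w c d : R[i]) : cabs w <= 4^-1 ->
  binser w (c + d) = binser w c * binser w d.
Proof.
move=> w4; have [s cs] := nat_bound (cabs c); have [t dt] := nat_bound (cabs d).
pose a k m := cbin c k * w ^+ k * (cbin d m * w ^+ m).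
have half : 0 <= (2^-1 : R) < 1 by lra.
have [||S S1 S2] := @has_sum_antidiagonal R a
    (fun k => cbin c k * w ^+ k * binser w d) (2 ^+ s * 2 ^+ t) 2^-1 half.
- move=> k m; rewrite cabsM exprD mulrACA.
  by apply: ler_pM; rewrite ?cabs_ge0// cabs_cbin_exp_le.
- by move=> k; apply: has_sumZ; exact: binser_has_sum.
have S1' : has_sum (fun k => cbin c k * w ^+ k * binser w d)
    (binser w c * binser w d).
  rewrite mulrC; have h := has_sumZ (c := binser w d) (binser_has_sum (c := c) w4).
  by refine (has_sum_eq h _) => k; rewrite mulrC.
rewrite -(has_sum_unique S1 S1'); apply: (has_sum_unique _ S2).
apply: (has_sum_eq (binser_has_sum (c := (c + d)) w4)) => m.
rewrite -cbin_vandermonde big_distrl/= !big_nat; apply: eq_bigr => k /andP[_ km].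
by rewrite /a -[in LHS](subnKC (km : k <= m)%N) exprD addKn; ring.
Qed.

Lemma binser0 (R : realType) (w : R[i]) : cabs w <= 4^-1 -> binser w 0 = 1.
Proof.
move=> w4; have b0 : has_sum (fun m => cbin 0 m * w ^+ m) (\sum_(0 <= k < 1) cbin 0 k * w ^+ k).
  apply: has_sum_finite => -[//|m _].
  have := cbinS (0 : R[i]) m; elim: m => [|m IH].
    rewrite subrr mul0r => /eqP; rewrite mulf_eq0 pnatr_eq0/= => /eqP ->.
    by rewrite mul0r.
  move=> h; have := cbinS (0 : R[i]) m => /IH/eqP.
  rewrite mulf_eq0; have [-> _|w0] := eqVneq w 0; first by rewrite expr0n mulr0.
  rewrite expf_eq0 (negPf w0) andbF orbF => /eqP b0; move: h.
  by rewrite b0 mulr0 => /eqP; rewrite mulf_eq0 pnatr_eq0/= => /eqP ->; rewrite mul0r.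
rewrite (has_sum_unique (binser_has_sum (c := 0) w4) b0).
by rewrite big_nat1 cbin0 expr0 mulr1.
Qed.

Lemma binser1 (R : realType) (w : R[i]) : cabs w <= 4^-1 -> binser w 1 = 1 + w.
Proof.
move=> w4.
have c1 : cbin (1 : R[i]) 1 = 1.
  by have := cbinS (1 : R[i]) 0; rewrite mul1r cbin0 subr0 mulr1.
have b0 : has_sum (fun m => cbin 1 m * w ^+ m) (\sum_(0 <= k < 2) cbin 1 k * w ^+ k).
  apply: has_sum_finite => -[|[|m]]// _.
  suff -> : cbin (1 : R[i]) m.+2 = 0 by rewrite mul0r.
  elim: m => [|m IH]; have := cbinS (1 : R[i]) _.
    move=> /(_ 1%N)/eqP; rewrite subrr mul0r mulf_eq0 pnatr_eq0/=.
    by move/eqP.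
  by move=> /(_ m.+2)/eqP; rewrite IH mulr0 mulf_eq0 pnatr_eq0/= => /eqP.
rewrite (has_sum_unique (binser_has_sum (c := 1) w4) b0).
by rewrite !big_nat_recr//= big_geq// add0r cbin0 c1 expr0 expr1 mulr1 mul1r.
Qed.

(** The Taylor coefficients of [log (1 + w)]; they are also the linear parts in [c] of the
    coefficients [cbin c m]. *)
Definition log_coef (R : realType) (m : nat) : R[i] :=
  if m is m'.+1 then (-1) ^+ m' / m%:R else 0.

(** After division by [m + 1], the error in replacing [cbin c (m + 1)] by its linear part is at most
    [|c|^2], uniformly in [m]. In the induction, [m (1 / (m + 1) + 1) + 1 / (m + 1) = m + 1]. *)
Lemma cbin_first_order (R : realType) (c : R[i]) m : cabs c <= 1 ->
  cabs (m.+1%:R * cbin c m.+1 - c * (-1) ^+ m) <= m%:R * cabs c ^+ 2.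
Proof.
move=> c1; elim: m => [|m IH].
  by rewrite cbinS cbin0 expr0 !mulr1 subr0 subrr cabs0 mul0r.
set e := m.+1%:R * cbin c m.+1 - c * (-1) ^+ m in IH.
have m0 : m.+1%:R != 0 :> R[i] by rewrite pnatr_eq0.
have n0 : 0 < m.+1%:R :> R by rewrite ltr0n.
have -> : m.+2%:R * cbin c m.+2 - c * (-1) ^+ m.+1 =
    e * (c / m.+1%:R - 1) + (c ^+ 2 / m.+1%:R) * (-1) ^+ m.
  by rewrite cbinS /e exprS; field; rewrite addrC natr1.
apply: le_trans (ler_cabsD _ _) _.
rewrite [cabs (_ * (-1) ^+ m)]cabsM cabsX cabsN cabs1 expr1n mulr1.
rewrite [cabs (e * _)]cabsM [cabs (c ^+ 2 / _)]cabsM cabsV cabs_nat cabsX.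
have h : cabs (c / m.+1%:R - 1) <= m.+1%:R^-1 + 1.
  apply: le_trans (ler_cabsB _ _) _; rewrite cabs1 lerD2r cabsM cabsV cabs_nat.
  by rewrite ler_pdivrMr// mulVf// gt_eqF.
apply: (@le_trans _ _ (m%:R * cabs c ^+ 2 * (m.+1%:R^-1 + 1) +
    cabs c ^+ 2 / m.+1%:R)).
  by rewrite lerD2r; apply: ler_pM => //; exact: cabs_ge0.
rewrite le_eqVlt; apply/orP; left; apply/eqP.
by rewrite -natr1 in n0 *; field; rewrite gt_eqF.
Qed.

Lemma binser_cexp (R : realType) (w : R[i]) : cabs w <= 4^-1 ->
  exists2 L : R[i], cabs L <= 3^-1 & forall c, binser w c = cexp (c * L).
Proof.
move=> w4; have w0 := cabs_ge0 w.
have quarter : 0 <= (4^-1 : R) < 1 by lra.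
have lb k : cabs (log_coef R k) <= 1.
  case: k => [|k]; first by rewrite /log_coef cabs0.
  rewrite /log_coef cabsM cabsX cabsN cabs1 expr1n mul1r cabsV cabs_nat.
  by rewrite invf_le1 ?ltr0n// ler1n.
have wX k : cabs w ^+ k <= 4^-1 ^+ k by rewrite lerXn2r ?nnegrE.
have lw k : cabs (log_coef R k * w ^+ k) <= 1 * 4^-1 ^+ k.
  by rewrite cabsM cabsX; apply: ler_pM; rewrite ?exprn_ge0 ?cabs_ge0.
have [L hL] := geometric_has_sum quarter lw.
exists L.
  have := geometric_tail 1 quarter lw hL.
  rewrite big_nat1 /log_coef mul0r subr0 => /le_trans; apply.
  by rewrite le_eqVlt; apply/orP; left; apply/eqP; field.
(* Each coefficient of the remainder is at most [|c|^2], and 4/3 is the sum of the powers of 1/4.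
   Without the zeroth power that sum is 1/3, the bound on [L]. *)
apply: (@cexp_of_first_order _ _ _ (4 / 3)).
  move=> c n; elim: n => [|n IH]; first by rewrite mul0r binser0// expr0.
  by rewrite -natr1 mulrDl mul1r binserD// IH exprSr.
move=> c c1.
have h1 := has_sumD (binser_has_sum (c := c) w4) (has_sumZ (c := - c) hL).
(* This series removes the constant term [cbin c 0 = 1]. *)
have h2 : has_sum (fun m => - (m == 0%N)%:R : R[i]) (-1).
  have := @has_sum_finite R (fun m => - (m == 0%N)%:R) 1.
  by rewrite big_nat1/=; apply => -[//|k _]; rewrite oppr0.
have := has_sumD h1 h2.
set u := fun k => _; rewrite mulNr addrAC => hu.
have ub k : cabs (u k) <= cabs c ^+ 2 * 4^-1 ^+ k.
  rewrite /u; case: k => [|k].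
    rewrite /log_coef cbin0 expr0 !mulr1 mulr0 addr0 /= subrr cabs0.
    by rewrite sqr_ge0.
  rewrite /= oppr0 addr0 mulrA -mulrDl cabsM cabsX.
  apply: ler_pM; rewrite ?exprn_ge0 ?cabs_ge0//.
  have k0 : k.+1%:R != 0 :> R[i] by rewrite pnatr_eq0.
  have kp : 0 < k.+1%:R :> R by rewrite ltr0n.
  rewrite -(ler_pM2l kp) -[X in X * cabs _](cabs_nat R) -cabsM.
  have -> : k.+1%:R * (cbin c k.+1 + - c * log_coef R k.+1) =
      k.+1%:R * cbin c k.+1 - c * (-1) ^+ k.
    by rewrite /log_coef; field.
  apply: le_trans (cbin_first_order k c1) _.
  by rewrite ler_wpM2r ?sqr_ge0// ler_nat.
have := geometric_tail 0 quarter ub hu.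
rewrite big_geq// subr0 expr0 mulr1 => /le_trans; apply.
by rewrite le_eqVlt; apply/orP; left; apply/eqP; field.
Qed.

Lemma cabs_exprB1_le (R : realType) (u : R[i]) k : cabs (u - 1) <= 1 ->
  cabs (u ^+ k - 1) <= (2 ^+ k - 1) * cabs (u - 1).
Proof.
move=> u1; elim: k => [|k IH]; first by rewrite !expr0 !subrr mul0r cabs0.
have -> : u ^+ k.+1 - 1 = u * (u ^+ k - 1) + (u - 1) by rewrite exprS; ring.
apply: le_trans (ler_cabsD _ _) _; rewrite cabsM.
have u2 : cabs u <= 2 by have := ler_cabsD (u - 1) 1; rewrite subrK cabs1; lra.
have := @ler_pM _ _ _ _ _ (cabs_ge0 u) (cabs_ge0 (u ^+ k - 1)) u2 IH.
by rewrite [2 ^+ k.+1]exprS; lra.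
Qed.

Lemma exprVB1_small (R : realType) (N : nat) (e : R) : 0 < e ->
  exists2 d : R, 0 < d & forall u : R[i], cabs (u - 1) < d ->
    [/\ u != 0, cabs (u ^+ N - 1) < e & cabs (u ^- N - 1) < e].
Proof.
move=> e0; have p0 : 0 < 2 ^+ N :> R by rewrite exprn_gt0.
have p1 : 1 <= 2 ^+ N :> R by rewrite exprn_ege1// ler1n.
(* Once [|u^N - 1| < 1/2], the modulus of [u^N] exceeds 1/2, so passing to the inverse costs a
   factor 2; hence [e / 2]. *)
exists (Num.min (2^-1) (e / 2) / 2 ^+ N).
  by rewrite divr_gt0// lt_min invr_gt0 ltr0n divr_gt0.
move=> u; rewrite ltr_pdivlMr// lt_min => /andP[h1 h2].
have u0' := cabs_ge0 (u - 1).
have u1 : cabs (u - 1) < 1 by nra.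
have hN := cabs_exprB1_le N (ltW u1).
have u0 : u != 0.
  by apply: contraTneq u1 => ->; rewrite sub0r cabsN cabs1 ltxx.
have uN : cabs (u ^+ N - 1) < 2^-1 by nra.
have uN' : cabs (u ^+ N - 1) < e / 2 by nra.
split=> //; first by lra.
have uN0 : u ^+ N != 0 by rewrite expf_neq0.
have -> : u ^- N - 1 = (1 - u ^+ N) / u ^+ N by rewrite mulrBl mul1r divff.
rewrite cabsM cabsV cabsBC ltr_pdivrMr ?cabs_gt0//.
have := ler_cabsD (u ^+ N) (1 - u ^+ N); rewrite addrC subrK cabs1 [cabs (1 - _)]cabsBC.
nra.
Qed.

Lemma binomial_series (R : realType) (N : nat) :
  exists2 d : R, 0 < d & forall u : R[i], cabs (u - 1) < d ->
    forall c, has_sum (fun m => cbin c m * (u ^- N - 1) ^+ m)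
                      (cpow u (- (N%:R * c))).
Proof.
have [d1 d10 h1] := @exprVB1_small R N 4^-1 ltac:(lra).
(* Taking [N + 1] instead of [N] keeps this bound positive when [N = 0], and still gives
   [N |carg u| <= 1]. *)
have [d2 d20 h2] := @norm_carg_lt R (N.+1%:R^-1) ltac:(by rewrite invr_gt0 ltr0n).
exists (Num.min d1 d2); first by rewrite lt_min d10.
move=> u; rewrite lt_min => /andP[/h1[u0 _ /ltW w4] /h2 ua] c.
have [L L3 hL] := binser_cexp w4.
have := binser_has_sum (c := c) w4.
(* Evaluating at exponent 1 shows that [cexp L = u^-N]. The imaginary part of [L + N clog u] is at
   most [1/3 + 1 < 2], which excludes a period. *)
suff LE : L = - (N%:R * clog u).
  by rewrite hL LE mulrN mulrA (mulrC c) -mulNr -/(cpow _ _).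
apply/eqP; rewrite -subr_eq0 opprK; apply/eqP; apply: cexp_eq1; last first.
  rewrite cexpD cexpMn clogK// -[L]mul1r -hL binser1// addrC subrK mulVf//.
  by rewrite expf_neq0.
have -> : complex.Im (L + N%:R * clog u) = complex.Im L + N%:R * carg u.
  by rewrite natrC /clog raddfD/=; simpc.
apply: le_lt_trans (ler_normD _ _) _.
have := le_trans (ler_Im_cabs L) L3.
suff : `|N%:R * carg u| <= 1 by lra.
rewrite normrM normr_nat; apply: (@le_trans _ _ (N.+1%:R * N.+1%:R^-1)).
  by apply: ler_pM => //; rewrite ?ler_nat// ltW.
by rewrite divff// pnatr_eq0.
Qed.

(** * Gould's transformation and the rational function F *)

(** Here [rho] may exceed 1: the growth is compensated by taking [w] small. *)
Definition geobounded (R : realType) (f : nat -> R[i]) : Prop :=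
  exists C rho : R,
    [/\ 0 <= C, 0 <= rho & forall k, cabs (f k) <= C * rho ^+ k].

Lemma geobounded_cst (R : realType) (c : R[i]) : geobounded (fun=> c).
Proof.
exists (cabs c), 1; split=> //; first exact: cabs_ge0.
by move=> k; rewrite expr1n mulr1.
Qed.

Lemma geoboundedM (R : realType) (f g : nat -> R[i]) :
  geobounded f -> geobounded g -> geobounded (fun k => f k * g k).
Proof.
move=> [C [r [C0 r0 fC]]] [D [s [D0 s0 gD]]]; exists (C * D), (r * s).
split; rewrite ?mulr_ge0// => k; rewrite cabsM exprMn mulrACA.
by apply: ler_pM; rewrite ?cabs_ge0.
Qed.

Lemma geobounded_prod (R : realType) (f : nat -> nat -> R[i]) m n :
  (forall i, (m <= i < n)%N -> geobounded (f i)) ->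
  geobounded (fun k => \prod_(m <= i < n) f i k).
Proof.
elim: n => [|n IH] fb.
  have [C [r [C0 r0 h]]] := geobounded_cst (1 : R[i]).
  by exists C, r; split=> // k; rewrite big_geq.
have [mn|nm] := leqP m n; last first.
  have [C [r [C0 r0 h]]] := geobounded_cst (1 : R[i]).
  by exists C, r; split=> // k; rewrite big_geq.
have h1 : geobounded (fun k => \prod_(m <= i < n) f i k).
  by apply: IH => i /andP[mi ni]; apply: fb; rewrite mi ltnW.
have h2 : geobounded (f n) by apply: fb; rewrite mn /=.
have [C [r [C0 r0 h]]] := geoboundedM h1 h2.
by exists C, r; split=> // k; rewrite big_nat_recr//=; exact: h.
Qed.

Lemma geobounded_affine (R : realType) (z B : R[i]) :
  geobounded (fun k => z + B * k%:R).
Proof.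
exists (cabs z + cabs B), 2; split=> //; first by rewrite addr_ge0 ?cabs_ge0.
move=> k; apply: le_trans (ler_cabsD _ _) _; rewrite mulrDl.
have k2 : k%:R <= 2 ^+ k :> R by rewrite -natrX ler_nat ltnW// ltn_expl.
have k1 : 1 <= 2 ^+ k :> R by rewrite exprn_ege1// ler1n.
apply: lerD; first by rewrite ler_peMr// cabs_ge0.
by rewrite cabsM cabs_nat ler_wpM2l// cabs_ge0.
Qed.

(** From some [K] on, [|B| k >= |z| + 1] makes the inverse at most 1; the finitely many earlier
    values are summed into the constant. *)
Lemma geobounded_inv_affine (R : realType) (z B : R[i]) :
  (forall k, z + B * k%:R != 0) -> geobounded (fun k => (z + B * k%:R)^-1).
Proof.
move=> nz; have [->|B0] := eqVneq B 0.
  have [C [r [C0 r0 h]]] := geobounded_cst (z^-1 : R[i]).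
  by exists C, r; split=> // k; rewrite mul0r addr0.
have Bp : 0 < cabs B by rewrite cabs_gt0.
have [K hK] := nat_bound ((cabs z + 1) / cabs B).
exists (1 + \sum_(0 <= i < K) cabs (z + B * i%:R)^-1), 1; split=> //.
  by rewrite addr_ge0// sumr_ge0// => i _; exact: cabs_ge0.
move=> k; rewrite expr1n mulr1; have [kK|Kk] := ltnP k K; last first.
  rewrite -[leLHS]addr0 lerD ?sumr_ge0//; last by move=> i _; exact: cabs_ge0.
  rewrite cabsV invf_le1 ?cabs_gt0//.
  have := lerB_cabs (B * k%:R) (- z); rewrite opprK cabsN cabsM cabs_nat => h.
  rewrite addrC; apply: le_trans h; rewrite lerBrDr addrC.
  move: hK; rewrite ler_pdivrMr// => /le_trans; apply.
  by rewrite mulrC ler_pM2l// ler_nat.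
rewrite -[leLHS]add0r lerD//.
rewrite big_mkord (bigD1 (Ordinal kK))//= lerDl sumr_ge0// => i _.
exact: cabs_ge0.
Qed.

Lemma poch_addn (R : realType) (c : R[i]) (m n : nat) :
  poch c (m + n)%N = poch c m * poch (c + m%:R) n.
Proof.
elim: n => [|n IH]; first by rewrite addn0 [X in _ * X]poch_posE big_geq ?mulr1.
by rewrite addnS !poch_recr IH natrD -!mulrA addrA.
Qed.

(** Trinomial revision. It is what turns an antidiagonal of [gould_array] into a single coefficient
    of [gould_hat]. *)
Lemma cbin_bin (R : realType) (X : R[i]) r k : (k <= r)%N ->
  cbin X k * cbin (X - k%:R) (r - k) = 'C(r, k)%:R * cbin X r.
Proof.
move=> kr; rewrite /cbin.
have -> : poch (X - r%:R + 1) r =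
    poch (X - k%:R - (r - k)%:R + 1) (r - k)%N * poch (X - k%:R + 1) k.
  have -> : X - k%:R - (r - k)%:R + 1 = X - r%:R + 1 by rewrite natrB//; ring.
  have -> : X - k%:R + 1 = X - r%:R + 1 + (r - k)%:R by rewrite natrB//; ring.
  by rewrite -poch_addn subnK.
have fn m : m`!%:R != 0 :> R[i] by rewrite pnatr_eq0 -lt0n fact_gt0.
rewrite -(bin_fact kr) !natrM.
have b0 : 'C(r, k)%:R != 0 :> R[i] by rewrite pnatr_eq0 -lt0n bin_gt0.
move: (fn k) (fn (r - k)%N) b0.
move: (k`!%:R : R[i]) ((r - k)`!%:R : R[i]) ('C(r, k)%:R : R[i]) => x y b x0 y0 b0.
by field; rewrite x0 y0 b0.
Qed.

(** The transform behind [f_hat], with the weight left free: rationality is proved by building up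
    the weight factor by factor. *)
Definition gould_hat (R : realType) (A B : R[i]) (f : nat -> R[i]) (r : nat) :
    R[i] :=
  \sum_(0 <= k < r.+1) (-1) ^+ k * 'C(r, k)%:R * cbin (A + B * k%:R) r * f k.

Definition gould_array (R : realType) (A B : R[i]) (f : nat -> R[i]) (w : R[i])
    (k m : nat) : R[i] :=
  cbin (A + B * k%:R) k * f k * (- w) ^+ k *
  (cbin (A + B * k%:R - k%:R) m * w ^+ m).

Lemma gould_antidiagonal (R : realType) (A B : R[i]) (f : nat -> R[i]) w r :
  \sum_(0 <= k < r.+1) gould_array A B f w k (r - k) =
  gould_hat A B f r * w ^+ r.
Proof.
rewrite /gould_hat big_distrl/= !big_nat; apply: eq_bigr => k /andP[_ kr].
rewrite -[in w ^+ r](subnKC (kr : k <= r)%N) exprD.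
rewrite -[_ * _ * cbin _ r]mulrA -(cbin_bin _ (kr : k <= r)%N) /gould_array.
by rewrite [(- w) ^+ k]exprNn; ring.
Qed.

Lemma cbin_affine_le (R : realType) (A B : R[i]) :
  exists2 s : R, 1 <= s & forall k m,
    cabs (cbin (A + B * k%:R) m) <= s * s ^+ k * 2 ^+ m.
Proof.
have [s hs] := nat_bound (cabs A); have [t ht] := nat_bound (cabs B).
exists (2 ^+ (s + t)); first by rewrite exprn_ege1// ler1n.
move=> k m; apply: (@le_trans _ _ (2 ^+ ((s + t * k) + m))).
  apply: cabs_cbin_le; apply: le_trans (ler_cabsD _ _) _.
  by rewrite natrD natrM lerD// cabsM cabs_nat ler_wpM2r.
rewrite -exprM -!exprD ler_weXn2l// ?ler1n// leq_add2r; nia.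
Qed.

Lemma gould_array_le (R : realType) (A B : R[i]) (f : nat -> R[i]) :
  geobounded f -> exists C sg : R, [/\ 0 <= C, 0 < sg & forall w k m,
    cabs (gould_array A B f w k m) <= C * (sg * cabs w) ^+ (k + m)].
Proof.
move=> [C [r [C0 r0 fC]]].
have [s s1 hs] := cbin_affine_le A B; have [t t1 ht] := cbin_affine_le A (B - 1).
have s0 : 0 < s by exact: lt_le_trans s1.
have t0 : 0 < t by exact: lt_le_trans t1.
(* An increment of [k] costs [s] and 2 from the first binomial coefficient, [t] from the second and
   [r] from [f]; an increment of [m] costs only 2. The maximum covers both. *)
pose sg := Num.max 2 (s * t * 2 * r).
have sg2 : 2 <= sg by rewrite le_max lexx.
have sgr : s * t * 2 * r <= sg by rewrite le_max lexx orbT.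
exists (s * C * t), sg; split; [by rewrite !mulr_ge0// ltW|exact: lt_le_trans sg2|].
move=> w k m; rewrite /gould_array 3!cabsM [cabs (cbin _ m * _)]cabsM !cabsX cabsN.
have -> : A + B * k%:R - k%:R = A + (B - 1) * k%:R by ring.
set W := cabs w; have W0 : 0 <= W by exact: cabs_ge0.
apply: (@le_trans _ _ ((s * s ^+ k * 2 ^+ k) * (C * r ^+ k) * W ^+ k *
   ((t * t ^+ k * 2 ^+ m) * W ^+ m))).
  have W1 j : 0 <= W ^+ j by rewrite exprn_ge0.
  apply: ler_pM; rewrite ?mulr_ge0 ?cabs_ge0//.
    by rewrite ler_wpM2r//; apply: ler_pM; rewrite ?cabs_ge0.
  by rewrite ler_wpM2r.
have -> : s * s ^+ k * 2 ^+ k * (C * r ^+ k) * W ^+ k *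
    (t * t ^+ k * 2 ^+ m * W ^+ m) =
  s * C * t * ((s * t * 2 * r * W) ^+ k * (2 * W) ^+ m).
  by rewrite !exprMn; ring.
have sg0 : 0 <= sg by apply: le_trans sg2.
have a0 : 0 <= s * t * 2 * r by rewrite !mulr_ge0// ltW.
apply: ler_wpM2l; first by rewrite !mulr_ge0// ltW.
rewrite exprD; apply: ler_pM.
- by rewrite exprn_ge0// mulr_ge0.
- by rewrite exprn_ge0// mulr_ge0.
- by apply: lerXn2r; [rewrite nnegrE mulr_ge0..|exact: ler_wpM2r].
- by apply: lerXn2r; [rewrite nnegrE mulr_ge0..|exact: ler_wpM2r].
Qed.

(** Provides convergence in [w] before any closed form of the sum is known; the rational function is
    then identified with this sum. *)
Lemma gould_hat_has_sum (R : realType) (A B : R[i]) (f : nat -> R[i]) :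
  geobounded f -> exists2 d : R, 0 < d & forall w, cabs w < d ->
    exists S, has_sum (fun r => gould_hat A B f r * w ^+ r) S.
Proof.
move=> /(gould_array_le A B)[C [sg [C0 sg0 h]]].
exists (sg^-1); first by rewrite invr_gt0.
move=> w wd; have rho : 0 <= sg * cabs w < 1.
  by rewrite mulr_ge0 ?cabs_ge0 ?ltW//= mulrC -ltr_pdivlMr// div1r.
have ex k : exists b, has_sum (gould_array A B f w k) b.
  apply: (geometric_has_sum rho (C := C * (sg * cabs w) ^+ k)) => m.
  by rewrite -mulrA -exprD.
have [b hb] := choice ex.
have [S _ hS] := has_sum_antidiagonal rho (h w) hb.
by exists S; refine (has_sum_eq hS _) => r; rewrite gould_antidiagonal.
Qed.

(* With [y = u ^ N], [w = (1 - y) / y] and [t = (y - 1) y^-B], one has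
   [y^-A t^k = (-w)^k (1 + w)^(A + B k - k)]; the two sides are the row and
   the antidiagonal summations of the resulting double series in [w]. *)
Lemma gould_has_sum (R : realType) (A B : R[i]) (f : nat -> R[i]) N :
  geobounded f -> exists2 d : R, 0 < d & forall u : R[i], cabs (u - 1) < d ->
    forall S, has_sum (fun r => gould_hat A B f r * ((1 - u ^+ N) / u ^+ N) ^+ r) S ->
    has_sum (fun k => cbin (A + B * k%:R) k * f k *
                      ((u ^+ N - 1) * cpow u (- (N%:R * B))) ^+ k)
            (cpow u (N%:R * A) * S).
Proof.
move=> /(gould_array_le A B)[C [sg [C0 sg0 h]]].
have sgV : 0 < sg^-1 by rewrite invr_gt0.
have [d1 d10 h1] := exprVB1_small N sgV.
have [d2 d20 h2] := binomial_series R N.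
exists (Num.min d1 d2); first by rewrite lt_min d10.
move=> u; rewrite lt_min => /andP[/h1[u0 _ wd] /h2 bs] S hS.
have uN0 : u ^+ N != 0 by rewrite expf_neq0.
set w := u ^- N - 1 in wd bs.
have wE : (1 - u ^+ N) / u ^+ N = w by rewrite mulrBl mul1r divff.
have rho : 0 <= sg * cabs w < 1.
  by rewrite mulr_ge0 ?cabs_ge0 ?ltW//= mulrC -ltr_pdivlMr// div1r.
have hb k : has_sum (gould_array A B f w k)
    (cbin (A + B * k%:R) k * f k * (- w) ^+ k *
     cpow u (- (N%:R * (A + B * k%:R - k%:R)))).
  by apply: has_sumZ; exact: bs.
have [S' hS1 hS2] := has_sum_antidiagonal rho (h w) hb.
have SS : S' = S.
  apply: has_sum_unique hS2 _; refine (has_sum_eq hS _) => r.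
  by rewrite gould_antidiagonal wE.
rewrite -SS; refine (has_sum_eq (has_sumZ (c := cpow u (N%:R * A)) hS1) _) => k.
have -> : - (N%:R * (A + B * k%:R - k%:R)) =
    - (N%:R * A) + (k%:R * - (N%:R * B) + k%:R * N%:R) by ring.
rewrite !cpowD [cpow u (k%:R * N%:R)]cpowMn [cpow u (k%:R * _)]cpowMn cpow_nat//.
rewrite [cpow u (- (N%:R * A))]cpowN [in RHS]exprMn.
have -> : (- w) ^+ k = (u ^+ N - 1) ^+ k / (u ^+ N) ^+ k.
  by rewrite -expr_div_n /w opprB mulrBl mul1r divff.
have uNk : (u ^+ N) ^+ k != 0 by rewrite expf_neq0.
have cA : cpow u (N%:R * A) != 0 by exact: cpow_neq0.
move: uNk cA; move: ((u ^+ N) ^+ k) (cpow u (N%:R * A)) => x y x0 y0.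
by field; rewrite x0 y0.
Qed.

(** * Rationality of the generating function of [f_hat] *)

Definition delay (R : realType) (h : nat -> R[i]) (r : nat) : R[i] :=
  if r is r'.+1 then h r' else 0.

(* Multiplication of the generating function by [1 + B w]. *)
Definition affmul (R : realType) (B : R[i]) (h : nat -> R[i]) (r : nat) : R[i] :=
  h r + B * delay h r.

(* The generating function of [h] is a polynomial over a power of [1 + B w]. *)
Definition ratgen (R : realType) (B : R[i]) (h : nat -> R[i]) : Prop :=
  exists m n, forall r, (n <= r)%N -> iter m (affmul B) h r = 0.

Lemma affmul_lin (R : realType) (B c : R[i]) (h g : nat -> R[i]) m r :
  iter m (affmul B) (fun r => c * h r + g r) r =
  c * iter m (affmul B) h r + iter m (affmul B) g r.
Proof.
elim: m r => [//|m IH] r; rewrite !iterS /affmul IH.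
by case: r => [|r]; rewrite /= ?IH; ring.
Qed.

(** Each further factor [1 + B w] raises the degree of the polynomial by at most one. *)
Lemma iter_affmul_eq0 (R : realType) (B : R[i]) (h : nat -> R[i]) m m' n :
  (m <= m')%N -> (forall r, (n <= r)%N -> iter m (affmul B) h r = 0) ->
  forall r, (n + (m' - m) <= r)%N -> iter m' (affmul B) h r = 0.
Proof.
move=> /subnK <-; rewrite addnK; elim: (m' - m)%N => [|j IH] h0 r.
  by rewrite addn0 => /h0.
rewrite addnS addSn iterS {1}/affmul; case: r => [//|r] nr /=.
by rewrite (IH h0 r.+1 (ltnW nr)) (IH h0 r nr) mulr0 addr0.
Qed.

Lemma ratgen_lin (R : realType) (B c : R[i]) (h g : nat -> R[i]) :
  ratgen B h -> ratgen B g -> ratgen B (fun r => c * h r + g r).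
Proof.
move=> [m1 [n1 h1]] [m2 [n2 h2]]; exists (m1 + m2)%N, (n1 + n2 + m1 + m2)%N.
move=> r nr; rewrite affmul_lin.
rewrite (iter_affmul_eq0 (leq_addr m2 m1) h1) ?(iter_affmul_eq0 (leq_addl m1 m2) h2).
- by rewrite mulr0 addr0.
- by lia.
- by lia.
Qed.

Lemma ratgen_fin (R : realType) (B : R[i]) (h : nat -> R[i]) n :
  (forall r, (n <= r)%N -> h r = 0) -> ratgen B h.
Proof. by exists 0%N, n. Qed.

Lemma ratgen_eq (R : realType) (B : R[i]) (h g : nat -> R[i]) :
  ratgen B h -> h =1 g -> ratgen B g.
Proof. by move=> rh /funext <-. Qed.

Lemma ratgenZ (R : realType) (B c : R[i]) (h : nat -> R[i]) :
  ratgen B h -> ratgen B (fun r => c * h r).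
Proof.
move=> rh; apply: ratgen_eq (ratgen_lin c rh (@ratgen_fin R B (fun=> 0) 0 _)) _ => //.
by move=> r; rewrite addr0.
Qed.

Lemma ratgen_delay (R : realType) (B : R[i]) (h : nat -> R[i]) :
  ratgen B h -> ratgen B (delay h).
Proof.
move=> [m [n hmn]]; exists m, n.+1.
have E r : iter m (affmul B) (delay h) r = delay (iter m (affmul B) h) r.
  elim: m {hmn} r => [//|m IH] r; rewrite iterS /affmul IH.
  by case: r => [|r] /=; rewrite ?mulr0 ?addr0// IH.
by move=> [//|r] nr; rewrite E /= hmn.
Qed.

Lemma ratgen_affmul (R : realType) (B : R[i]) (h : nat -> R[i]) :
  ratgen B (affmul B h) -> ratgen B h.
Proof. by move=> [m [n hmn]]; exists m.+1, n => r nr; rewrite iterSr hmn. Qed.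

(** On generating functions this is the Euler operator [E = w d/dw]. Since
    [(1 + B w) E H = E ((1 + B w) H) - B w H], and [(1 + B w) H] needs one denominator factor less
    than [H], induction on [m] applies. *)
Lemma ratgen_natmul (R : realType) (B : R[i]) (h : nat -> R[i]) :
  ratgen B h -> ratgen B (fun r => r%:R * h r).
Proof.
move=> [m [n hmn]]; elim: m h hmn => [|m IH] h hmn.
  by apply: (@ratgen_fin _ _ _ n) => r /hmn /= ->; rewrite mulr0.
apply: ratgen_affmul.
have h1 : ratgen B (fun r => r%:R * affmul B h r).
  by apply: IH => r nr; rewrite -iterSr hmn.
have h2 : ratgen B (delay h) by apply: ratgen_delay; exists m.+1, n.
apply: ratgen_eq (ratgen_lin (- B) h2 h1) _ => -[|r]; rewrite /affmul /=.
  by rewrite !mul0r !mulr0 !addr0.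
by rewrite -natr1; ring.
Qed.

Lemma ratgen_has_sum (R : realType) (B : R[i]) (h : nat -> R[i]) :
  ratgen B h -> exists m (P : {poly R[i]}), forall w S,
    has_sum (fun r => h r * w ^+ r) S -> (1 + B * w) ^+ m * S = P.[w].
Proof.
move=> [m [n hmn]]; exists m, (\poly_(i < n) iter m (affmul B) h i) => w S hS.
have : has_sum (fun r => iter m (affmul B) h r * w ^+ r) ((1 + B * w) ^+ m * S).
  elim: m {hmn} => [|m IH]; first by rewrite expr0 mul1r.
  have h2 := has_sumD IH (has_sumZ (c := B * w) (has_sum_shift IH)).
  have -> : (1 + B * w) ^+ m.+1 * S =
    (1 + B * w) ^+ m * S + B * w * ((1 + B * w) ^+ m * S) by rewrite exprS; ring.
  refine (has_sum_eq h2 _) => -[|r] /=; rewrite /affmul /=; first by ring.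
  by rewrite exprS; ring.
move/has_sum_unique; apply; rewrite horner_poly.
rewrite -(big_mkord xpredT (fun i => iter m (affmul B) h i * w ^+ i)).
apply: has_sum_finite => k nk.
by rewrite hmn// mul0r.
Qed.

Lemma sum_sign_bin (R : realType) r :
  \sum_(0 <= k < r.+1) (-1) ^+ k * 'C(r, k)%:R = (r == 0%N)%:R :> R[i].
Proof.
have := exprDn (1 : R[i]) (-1) r; rewrite subrr expr0n => ->.
rewrite big_mkord; apply: eq_bigr => k _.
by rewrite expr1n mul1r mulr_natr.
Qed.

(** Up to sign, the [r]-th finite difference at 0 of a polynomial of degree at most [r]. A factor
    [k] is absorbed by [k C(r + 1, k) = (r + 1) (C(r + 1, k) - C(r, k))]. *)
Lemma sum_sign_bin_poly (R : realType) (P : {poly R[i]}) r :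
  (size P <= r.+1)%N ->
  \sum_(0 <= k < r.+1) (-1) ^+ k * 'C(r, k)%:R * P.[k%:R] =
  (-1) ^+ r * r`!%:R * P`_r.
Proof.
elim/poly_ind: P r => [|Q c IH] r sz.
  by rewrite coef0 mulr0 big1// => k _; rewrite horner0 mulr0.
case: r sz => [|r] sz.
  by rewrite big_nat1 expr0 bin0 fact0 !mul1r horner_coef0.
have szQ : (size Q <= r.+1)%N.
  have [->|Q0] := eqVneq Q 0; first by rewrite size_poly0.
  by move: sz; rewrite size_MXaddC (negPf Q0).
have IH1 := IH _ (leqW szQ); have IH2 := IH _ szQ.
rewrite (nth_default _ szQ) mulr0 in IH1.
have -> : \sum_(0 <= k < r.+2) (-1) ^+ k * 'C(r.+1, k)%:R * (Q * 'X + c%:P).[k%:R] =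
  r.+1%:R * (\sum_(0 <= k < r.+2) (-1) ^+ k * 'C(r.+1, k)%:R * Q.[k%:R]) -
  r.+1%:R * (\sum_(0 <= k < r.+2) (-1) ^+ k * 'C(r, k)%:R * Q.[k%:R]) +
  c * \sum_(0 <= k < r.+2) (-1) ^+ k * 'C(r.+1, k)%:R.
  rewrite !big_distrr/= -sumrB -big_split/= !big_nat; apply: eq_bigr => k /andP[_ kr].
  rewrite hornerD hornerMX hornerC.
  have : (r.+1%:R - k%:R) * 'C(r.+1, k)%:R = r.+1%:R * 'C(r, k)%:R :> R[i].
    by rewrite -natrB// -!natrM mul_bin_down.
  move: ('C(r.+1, k)%:R : R[i]) ('C(r, k)%:R : R[i]) => x y xy.
  have -> : r.+1%:R * ((-1) ^+ k * x * Q.[k%:R]) -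
    r.+1%:R * ((-1) ^+ k * y * Q.[k%:R]) + c * ((-1) ^+ k * x) =
    (-1) ^+ k * (r.+1%:R * x - r.+1%:R * y) * Q.[k%:R] + c * ((-1) ^+ k * x) by ring.
  by rewrite -xy; ring.
rewrite IH1 sum_sign_bin !mulr0 addr0 sub0r big_nat_recr//= bin_small// mulr0 mul0r addr0.
rewrite IH2 coefD coefMX coefC /= addr0 factS natrM exprS; ring.
Qed.

(** For [m = 0] this is [r!] times the binomial coefficient of [A + B X] over [r]. A positive [m]
    means that the first [m] factors have been cancelled by a Pochhammer symbol of negative
    order. *)
Definition falling_poly (R : realType) (A B : R[i]) (m r : nat) : {poly R[i]} :=
  \prod_(m <= i < r) (B *: 'X + (A - i%:R)%:P).

Lemma size_falling_poly (R : realType) (A B : R[i]) m r :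
  (size (falling_poly A B m r) <= (r - m).+1)%N.
Proof.
rewrite /falling_poly; elim: r => [|r IH]; first by rewrite big_geq// size_poly1.
have [mr|rm] := leqP m r; last by rewrite big_geq// size_poly1.
rewrite big_nat_recr//= subSn//; apply: leq_trans (size_polyMleq _ _) _.
have : (size (B *: 'X + (A - r%:R)%:P)%R <= 2)%N.
  apply: leq_trans (size_polyD _ _) _; rewrite geq_max.
  rewrite (leq_trans (size_scale_leq _ _)) ?size_polyX//=.
  by rewrite (leq_trans (size_polyC_leq1 _)).
by move=> h2; have := leq_add IH h2; rewrite addn2; case: (_ + _)%N.
Qed.

Lemma coef_falling_poly (R : realType) (A B : R[i]) r :
  (falling_poly A B 0 r)`_r = B ^+ r.
Proof.
elim: r => [|r IH]; first by rewrite /falling_poly big_geq// coef1.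
rewrite /falling_poly big_nat_recr//= -/(falling_poly A B 0 r) mulrDr coefD.
rewrite -scalerAr coefZ coefMX /= IH [_ * _%:P]mulrC coefCM.
have := size_falling_poly A B 0 r; rewrite subn0 => /(nth_default 0) ->.
by rewrite mulr0 addr0 exprS.
Qed.

Lemma horner_falling_poly (R : realType) (A B : R[i]) m r x :
  (falling_poly A B m r).[x] = \prod_(m <= i < r) (A + B * x - i%:R).
Proof.
rewrite /falling_poly horner_prod; apply: eq_bigr => i _.
by rewrite hornerD hornerZ hornerX hornerC; ring.
Qed.

Lemma cbin_falling (R : realType) (X : R[i]) r :
  r`!%:R * cbin X r = \prod_(0 <= i < r) (X - i%:R).
Proof.
elim: r => [|r IH]; first by rewrite cbin0 big_geq// fact0 mulr1.
rewrite big_nat_recr//= -IH factS natrM -mulrA mulrCA cbinS; ring.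
Qed.

(** If [H] and [H1] are the generating functions for the weights [f] and [k f], and [E = w d/dw],
    this says [(1 + B w) H1 = E H + w (E - A) H]. Termwise, with [X = A + B k], it is [(r + 1 - k)
    C(r + 1, k) cbin X (r + 1) = (X - r) C(r, k) cbin X r]. *)
Lemma gould_hat_affmul (R : realType) (A B : R[i]) (f : nat -> R[i]) r :
  affmul B (gould_hat A B (fun k => k%:R * f k)) r =
  r%:R * gould_hat A B f r + delay (fun r => (r%:R - A) * gould_hat A B f r) r.
Proof.
case: r => [|r]; rewrite /affmul /=.
  by rewrite mulr0 mul0r !addr0 /gould_hat big_nat1 mul0r mulr0.
have E g : gould_hat A B g r = \sum_(0 <= k < r.+2)
    (-1) ^+ k * 'C(r, k)%:R * cbin (A + B * k%:R) r * g k.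
  by rewrite big_nat_recr//= bin_small// mulr0 !mul0r addr0.
rewrite (E (fun k => k%:R * f k)) (E f).
rewrite /gould_hat !big_distrr/= -!big_split/= !big_nat; apply: eq_bigr => k /andP[_ kr].
have e1 : (r.+1%:R - k%:R) * 'C(r.+1, k)%:R = r.+1%:R * 'C(r, k)%:R :> R[i].
  by rewrite -natrB// -!natrM mul_bin_down.
have e2 := cbinS (A + B * k%:R) r.
have e3 : (r.+1%:R - k%:R) * ('C(r.+1, k)%:R * cbin (A + B * k%:R) r.+1) =
    (A + B * k%:R - r%:R) * ('C(r, k)%:R * cbin (A + B * k%:R) r).
  transitivity ((r.+1%:R - k%:R) * 'C(r.+1, k)%:R * cbin (A + B * k%:R) r.+1).
    by ring.
  rewrite e1; transitivity ('C(r, k)%:R * (r.+1%:R * cbin (A + B * k%:R) r.+1)).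
    by ring.
  by rewrite e2; ring.
move: e3; move: (cbin _ r) (cbin _ r.+1) ('C(r, k)%:R : R[i]) ('C(r.+1, k)%:R : R[i]).
move=> x y b c e3.
apply/eqP; rewrite -subr_eq0; apply/eqP.
have -> : (-1) ^+ k * c * y * (k%:R * f k) + B * ((-1) ^+ k * b * x * (k%:R * f k)) -
  (r.+1%:R * ((-1) ^+ k * c * y * f k) + (r%:R - A) * ((-1) ^+ k * b * x * f k)) =
  (-1) ^+ k * f k * ((A + B * k%:R - r%:R) * (b * x) - (r.+1%:R - k%:R) * (c * y)) by ring.
by rewrite e3 subrr mulr0.
Qed.

Lemma gould_hat_lin (R : realType) (A B c : R[i]) (f g : nat -> R[i]) r :
  gould_hat A B (fun k => c * f k + g k) r =
  c * gould_hat A B f r + gould_hat A B g r.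
Proof.
rewrite /gould_hat big_distrr/= -big_split/=; apply: eq_bigr => k _; ring.
Qed.

Lemma gould_hatZ (R : realType) (A B c : R[i]) (f : nat -> R[i]) r :
  gould_hat A B (fun k => c * f k) r = c * gould_hat A B f r.
Proof. rewrite /gould_hat big_distrr/=; apply: eq_bigr => k _; ring. Qed.

Lemma gould_hat_eq (R : realType) (A B : R[i]) (f g : nat -> R[i]) r :
  f =1 g -> gould_hat A B f r = gould_hat A B g r.
Proof. by move=> /funext ->. Qed.

Lemma gould_hat_poly (R : realType) (A B : R[i]) (f : nat -> R[i])
    (P : {poly R[i]}) r :
  (size P <= r.+1)%N ->
  (forall k, r`!%:R * cbin (A + B * k%:R) r * f k = P.[k%:R]) ->
  gould_hat A B f r = (-1) ^+ r * P`_r.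
Proof.
move=> szP fP; have f0 : r`!%:R != 0 :> R[i] by rewrite pnatr_eq0 -lt0n fact_gt0.
apply: (mulfI f0); rewrite [RHS]mulrCA mulrA -sum_sign_bin_poly// big_distrr/=.
by apply: eq_bigr => k _; rewrite -fP; ring.
Qed.

Lemma gould_hat1 (R : realType) (A B : R[i]) r :
  gould_hat A B (fun=> 1) r = (- B) ^+ r.
Proof.
rewrite (@gould_hat_poly _ _ _ _ (falling_poly A B 0 r)).
- by rewrite coef_falling_poly [RHS]exprNn.
- by have := size_falling_poly A B 0 r; rewrite subn0.
- by move=> k; rewrite mulr1 cbin_falling horner_falling_poly.
Qed.

Lemma ratgen_gould_hat_prod (R : realType) (A B : R[i]) d :
  ratgen B (gould_hat A B (fun k => \prod_(0 <= i < d) (A + B * k%:R + 1 + i%:R))).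
Proof.
elim: d => [|d IH].
  apply: ratgen_affmul; apply: (@ratgen_fin _ _ _ 1) => -[//|r] _.
  have E k : gould_hat A B (fun k => \prod_(0 <= i < 0) (A + B * k%:R + 1 + i%:R)) k
    = (- B) ^+ k.
    by rewrite -(gould_hat1 A); apply: gould_hat_eq => j; rewrite big_geq.
  by rewrite /affmul /= !E exprS mulNr addNr.
set f := (fun k => _) in IH.
have h1 := ratgen_natmul IH.
have h2 : ratgen B (gould_hat A B (fun k => k%:R * f k)).
  apply: ratgen_affmul.
  have h3 := ratgen_delay (ratgen_lin (- A) IH h1).
  apply: ratgen_eq (ratgen_lin 1 h1 h3) _ => r.
  by rewrite gould_hat_affmul mul1r; congr (_ + _); case: r => //= r; ring.
apply: ratgen_eq (ratgen_lin (A + 1 + d%:R) IH (ratgenZ B h2)) _ => r.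
rewrite -(gould_hatZ A B B) -gould_hat_lin; apply: gould_hat_eq => k.
by rewrite big_nat_recr//= -/(f k); ring.
Qed.

Lemma poch_neg (R : realType) (c : R[i]) s :
  poch c (Negz s) = (\prod_(0 <= i < s.+1) (c - 1 - i%:R))^-1.
Proof.
rewrite /poch big_add1 /=; congr (_^-1); apply: eq_bigr => i _.
by rewrite -natr1; ring.
Qed.

Lemma poch_defined_neg (R : realType) (c : R[i]) s :
  poch_defined c (Negz s) -> \prod_(0 <= i < s.+1) (c - 1 - i%:R) != 0.
Proof.
rewrite (_ : \prod_(0 <= i < s.+1) _ = \prod_(1 <= i < s.+2) (c - i%:R))//.
by rewrite [RHS]big_add1 /=; apply: eq_bigr => i _; rewrite -natr1; ring.
Qed.

Lemma ratgen_f_hat (R : realType) ell (A B : R[i]) :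
  f_defined ell A B -> ratgen B (f_hat ell A B).
Proof.
move=> [_ _ fd].
have -> : f_hat ell A B = gould_hat A B (f_coef ell A B) by [].
suff h : ratgen B (gould_hat A B (fun k => poch (A + B * k%:R + 1) (ell - 1))).
  apply: ratgen_eq (ratgenZ (poch (A + 1) (ell - 1))^-1 h) _ => r.
  by rewrite -gould_hatZ; apply: gould_hat_eq => k; rewrite /f_coef mulrC.
case: (ell - 1) fd => [d|s] fd.
  exact: ratgen_gould_hat_prod.
(* The weight is the inverse of the first [s + 1] factors of the falling factorial. For [r > s]
   their product is a polynomial in [k] of degree at most [r - s - 1], which the [r]-th difference
   kills. *)
apply: (@ratgen_fin _ _ _ s.+1) => r sr.
rewrite (@gould_hat_poly _ _ _ _ (falling_poly A B s.+1 r)).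
- rewrite nth_default ?mulr0//; apply: leq_trans (size_falling_poly _ _ _ _) _.
  by lia.
- by apply: leq_trans (size_falling_poly _ _ _ _) _; lia.
move=> k; have := poch_defined_neg (fd k).
rewrite poch_neg cbin_falling horner_falling_poly (@big_cat_nat _ _ _ s.+1 0%N r)//=.
have -> : A + B * k%:R + 1 - 1 = A + B * k%:R by ring.
by move=> nz; rewrite mulrAC divff ?mul1r.
Qed.

Lemma geobounded_f_coef (R : realType) ell (A B : R[i]) :
  f_defined ell A B -> geobounded (f_coef ell A B).
Proof.
move=> [_ _ fd]; apply: geoboundedM (geobounded_cst _).
case: (ell - 1) fd => [d|s] fd.
  apply: (geobounded_prod (f := fun i k => A + B * k%:R + 1 + i%:R)) => i _.
  have [C [r [C0 r0 h]]] := geobounded_affine (A + 1 + i%:R) B.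
  exists C, r; split=> // k; apply: le_trans (h k).
  by rewrite (_ : _ + i%:R = A + 1 + i%:R + B * k%:R)//; ring.
have fn i k : (i < s.+1)%N -> A - i%:R + B * k%:R != 0.
  move=> si; have := poch_defined_neg (fd k).
  rewrite big_mkord => /prodf_neq0/(_ (Ordinal si) isT)/=.
  by congr (_ != 0); ring.
have [|C [r [C0 r0 h]]] :=
    @geobounded_prod R (fun i k => (A - i%:R + B * k%:R)^-1) 0 s.+1.
  by move=> i /andP[_ si]; apply: geobounded_inv_affine => k; exact: fn.
exists C, r; split=> // k; apply: le_trans (h k).
rewrite le_eqVlt; apply/orP; left; apply/eqP; congr cabs.
rewrite poch_neg -prodfV; apply: eq_bigr => i _; congr (_^-1); ring.
Qed.

Lemma F_ratfun_exists (R : realType) ell (A B : R[i]) :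
  f_defined ell A B -> exists F, is_F_ratfun ell A B F.
Proof.
move=> fd.
have [d1 d10 h1] := gould_hat_has_sum A B (geobounded_f_coef fd).
have [m [P hP]] := ratgen_has_sum (ratgen_f_hat fd).
pose s := size P.
(* Substituting [w = (1 - y) / y] in [P(w) / (1 + B w)^m] and clearing denominators by [y^s] gives
   [N0 / D0]. Division by the gcd is needed because [is_F_ratfun] asks for a reduced fraction. *)
pose N0 : {poly R[i]} := (\sum_(i < s) P`_i *: ((1 - 'X) ^+ i * 'X ^+ (s - i))) * 'X ^+ m.
pose D0 : {poly R[i]} := 'X ^+ s * ('X + B *: (1 - 'X)) ^+ m.
pose E := gcdp N0 D0.
(* The first bound gives [|y| > 1/2], the second then [|w| < d1], and the third makes
   [y + B (1 - y) = 1 + (B - 1) (1 - y)] nonzero. *)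
pose d := Num.min (2^-1) (Num.min (d1 / 2) ((2 * (1 + cabs B))^-1)).
have B1 : 0 < 1 + cabs B by have := cabs_ge0 B; lra.
have d0 : 0 < d.
  by rewrite /d !lt_min invr_gt0 ltr0n divr_gt0//= invr_gt0 mulr_gt0.
have near y : cabs (y - 1) < d ->
    [/\ y != 0, y + B * (1 - y) != 0 & cabs ((1 - y) / y) < d1].
  rewrite /d !lt_min => /and3P[y1 y2 y3]; have c0 := cabs_ge0 (y - 1).
  have yb : 2^-1 < cabs y.
    by have := ler_cabsD (1 - y) y; rewrite subrK cabs1 cabsBC; lra.
  have y0 : y != 0 by rewrite -cabs_gt0; lra.
  split=> //.
    have : cabs ((B - 1) * (1 - y)) < 1.
      rewrite cabsM cabsBC [cabs (1 - y)]cabsBC.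
      have := ler_cabsB 1 B; rewrite cabs1 => b1.
      have : cabs (1 - B) * cabs (y - 1) <= (1 + cabs B) * cabs (y - 1).
        by rewrite ler_wpM2r.
      move: y3; rewrite -div1r ltr_pdivlMr ?mulr_gt0//.
      by move: (cabs (y - 1)) (cabs B) => t b; lra.
    apply: contraTneq => y1'; have -> : (B - 1) * (1 - y) = y + B * (1 - y) - 1 by ring.
    by rewrite y1' sub0r cabsN cabs1 ltxx.
  rewrite cabsM cabsV cabsBC ltr_pdivrMr ?cabs_gt0//.
  have : d1 / 2 < d1 * cabs y by rewrite ltr_pM2l.
  lra.
have D0E y : D0.[y] = y ^+ s * (y + B * (1 - y)) ^+ m.
  by rewrite hornerM !horner_exp hornerD hornerZ hornerD hornerN !hornerX hornerC.
have D00 y : cabs (y - 1) < d -> D0.[y] != 0.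
  by move=> /near[y0 yB _]; rewrite D0E mulf_neq0 ?expf_neq0.
have D0n : D0 != 0.
  have : D0.[1] != 0 by rewrite D00// subrr cabs0.
  by apply: contraNneq => ->; rewrite horner0.
have NK : N0 %/ E * E = N0 by rewrite divpK ?dvdp_gcdl.
have DK : D0 %/ E * E = D0 by rewrite divpK ?dvdp_gcdr.
have cop : coprimep (N0 %/ E) (D0 %/ E) by rewrite coprimep_div_gcd// D0n orbT.
exists (N0 %/ E, D0 %/ E); split=> //.
clear cop; clearbody E; move: (N0 %/ E) (D0 %/ E) NK DK => N D NK DK.
exists d => // y; rewrite cabsE ltcR => yd.
have [y0 yB wd] := near y yd; have := D00 y yd.
have [S hS] := h1 _ wd; have := hP _ _ hS.
set w := (1 - y) / y in hS * => PS D0y.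
have N0y : S * D0.[y] = N0.[y].
  rewrite D0E /N0 hornerM horner_exp hornerX horner_sum.
  have -> : y + B * (1 - y) = y * (1 + B * w) by rewrite /w; field.
  rewrite exprMn; transitivity (y ^+ s * ((1 + B * w) ^+ m * S) * y ^+ m); first by ring.
  rewrite PS horner_coef big_distrr/=; congr (_ * _); apply: eq_bigr => i _.
  rewrite hornerZ hornerM !horner_exp hornerD hornerN hornerC hornerX.
  have -> : y ^+ s = y ^+ i * y ^+ (s - i) by rewrite -exprD subnKC// ltnW.
  rewrite /w expr_div_n.
  have yi : y ^+ i != 0 by rewrite expf_neq0.
  by move: (y ^+ i) yi => z z0; field.
move: D0y N0y; rewrite -DK -NK !hornerM mulf_eq0 negb_or.
move=> /andP[Dy Ey] SDE; split; first exact: Dy.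
suff -> : N.[y] / D.[y] = S by [].
apply: (canLR (mulfK Dy)); apply: (mulIf Ey).
by rewrite -mulrA SDE.
Qed.

Lemma F_rat_has_sum (R : realType) ell (A B : R[i]) :
  f_defined ell A B -> exists2 d : R, 0 < d & forall y : R[i], cabs (y - 1) < d ->
    has_sum (fun r => f_hat ell A B r * ((1 - y) / y) ^+ r) (F_rat ell A B y).
Proof.
move=> fd; have := xgetPex (0, 1) (F_ratfun_exists fd).
rewrite /F_rat; case: (xget _ _) => N D /= [_ [d d0 h]]; exists d => // y yd.
by have [] := h y; rewrite ?cabsE ?ltcR.
Qed.

Lemma F_rat_expansion (R : realType) ell (A B : R[i]) N :
  f_defined ell A B -> exists2 d : R, 0 < d & forall u : R[i], cabs (u - 1) < d ->
    has_sum (fun k => cbin (A + B * k%:R) k * f_coef ell A B k *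
                      ((u ^+ N - 1) * cpow u (- (N%:R * B))) ^+ k)
            (cpow u (N%:R * A) * F_rat ell A B (u ^+ N)).
Proof.
move=> fd; have [d1 d10 h1] := gould_has_sum A B N (geobounded_f_coef fd).
have [d2 d20 h2] := F_rat_has_sum fd.
have [d3 d30 h3] := exprVB1_small N d20.
exists (Num.min d1 d3); first by rewrite lt_min d10.
move=> u; rewrite lt_min => /andP[u1 /h3[_ uN _]].
by apply: h1 => //; exact: h2.
Qed.

(** * Pochhammer symbols of integer order *)

(** A form uniform in the sign of [r], which reduces comparisons of orders to linear integer
    arithmetic. *)
Lemma poch_definedP (R : realType) (c : R[i]) (r : int) :
  poch_defined c r <->
  (forall i : nat, (0 < i)%N -> i%:Z <= - r -> c - i%:R != 0).
Proof.
case: r => [m|s]; first by split=> // _ i i0 im; exfalso; lia.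
split=> /= [|h].
  rewrite prodf_seq_neq0 => /allP h i i0 im.
  have := h i; rewrite mem_index_iota /=; apply.
  by rewrite i0 /=; lia.
rewrite big_nat_cond prodf_seq_neq0; apply/allP => i _; apply/implyP.
by move=> /andP[/andP[i0 im] _]; apply: h => //; lia.
Qed.

(** Holds even at the poles: both sides are inverses of the same product up to sign, and the inverse
    of zero is zero. *)
Lemma poch_reflection (R : realType) (x : R[i]) (m : int) :
  poch (1 - x) (- m) = (-1) ^+ `|m|%N / poch x m.
Proof.
have sgn (F : nat -> R[i]) l r : (l <= r)%N ->
  \prod_(l <= i < r) - F i = (-1) ^+ (r - l) * \prod_(l <= i < r) F i.
  move=> lr; rewrite (eq_bigr (fun i => -1 * F i)); last by move=> i _; rewrite mulN1r.
  by rewrite big_split/= prodr_const_nat.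
case: m => [[|m]|s].
- by rewrite oppr0 !poch_posE !big_geq// invr1 mulr1 /= expr0.
- rewrite -NegzE /poch absz_nat -[X in X * _]invrK -invfM -exprVn invrN1.
  rewrite -[X in (-1) ^+ X]subn0 -sgn// big_add1 /=; congr (_^-1).
  by apply: eq_bigr => i _; rewrite -natr1; ring.
- rewrite NegzE opprK abszN absz_nat -NegzE /poch invrK.
  rewrite big_add1 /= -[X in (-1) ^+ X]subn0 -sgn//.
  by apply: eq_bigr => i _; rewrite -natr1; ring.
Qed.

(** By reflection, the zeros of [(x)_m] are the poles of [(1 - x)_(-m)]. *)
Lemma poch_neq0 (R : realType) (x : R[i]) (m : int) :
  poch_defined x m -> poch_defined (1 - x) (- m) -> poch x m != 0.
Proof.
case: m => [m _ /poch_definedP h|s]; last by move=> /= h _; rewrite invr_eq0.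
rewrite poch_posE big_nat_cond prodf_seq_neq0; apply/allP => i _.
apply/implyP => /andP[/andP[_ im] _].
have := h i.+1 isT; rewrite opprK => /(_ _)/negPf; rewrite -natr1.
move=> hh; apply/negP => /eqP xi; move: hh.
have -> : 1 - x - (i%:R + 1) = - (x + i%:R) by ring.
by rewrite xi oppr0 eqxx => /(_ _); move=> /(_ ltac:(lia)).
Qed.

Lemma poch_defined_le (R : realType) (x : R[i]) (m r : int) :
  m <= r -> poch_defined x m -> poch_defined x r.
Proof.
by move=> mr /poch_definedP h; apply/poch_definedP => i i0 ir; apply: h => //; lia.
Qed.

Lemma poch_step (R : realType) (x : R[i]) (m : int) :
  poch_defined x m -> poch x (m + 1) = poch x m * (x + m%:~R).
Proof.
case: m => [m _|[|s]].
- by rewrite -[Posz m + 1]/(Posz (m + 1)) addn1 poch_recr.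
- move=> /poch_definedP/(_ 1%N isT isT) h.
  rewrite -[Negz 0 + 1]/(Posz 0) [LHS]poch_posE big_geq// /poch big_nat1.
  by rewrite NegzE rmorphN/= mulVf.
- move=> h.
  have -> : (Negz s.+1 + 1) = Negz s by rewrite !NegzE; lia.
  rewrite /= NegzE rmorphN/= -pmulrn [in RHS]big_nat_recr//= invfM.
  rewrite -mulrA mulVf ?mulr1//.
  by move/poch_definedP : h => /(_ s.+2 isT); apply; rewrite NegzE opprK.
Qed.

(** Definedness is essential: as the inverse of zero is zero, [x = 0], [m = 1], [r = -1] would give
    1 on the left and 0 on the right. *)
Lemma poch_add (R : realType) (x : R[i]) (m r : int) :
  poch_defined x m -> poch_defined (x + m%:~R) r ->
  poch x (m + r) = poch x m * poch (x + m%:~R) r.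
Proof.
case: r => [r|s] mh.
  move=> _; elim: r => [|r IH]; first by rewrite addr0 [X in _ * X]poch_posE big_geq// mulr1.
  rewrite -addn1 PoszD addrA poch_step ?IH; last first.
    by apply: poch_defined_le mh; lia.
  by rewrite -[Posz r + 1]/(Posz (r + 1)) addn1 poch_recr rmorphD/= -!mulrA addrA.
elim: s => [|s IH] rh; rewrite NegzE.
  have /poch_definedP/(_ 1%N isT isT) h1 := rh.
  have h2 : x + (m - 1)%:~R != 0 by move: h1; rewrite rmorphB/= addrA.
  have hd : poch_defined x (m - 1).
    apply/poch_definedP => i i0 im; have [ile|igt] := lerP i%:Z (- m).
      by move/poch_definedP : mh; apply.
    have -> : i%:R = - (m - 1)%:~R :> R[i].
      by rewrite pmulrn -rmorphN; congr (_%:~R); lia.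
    by rewrite opprK.
  have := poch_step hd; rewrite subrK => ->.
  rewrite [poch (x + _) _]/= big_nat1 -mulrA rmorphB/= addrA divff ?mulr1//.
have IHd : poch_defined (x + m%:~R) (Negz s).
  by apply: poch_defined_le rh; rewrite !NegzE; lia.
have /poch_definedP/(_ s.+2 isT) := rh; rewrite NegzE opprK lexx => /(_ isT) h1.
have h2 : x + (m - s.+2%:Z)%:~R != 0.
  by move: h1; rewrite rmorphB/= addrA.
have hd : poch_defined x (m - s.+2%:Z).
  apply/poch_definedP => i i0 im; have [ile|igt] := lerP i%:Z (- m).
    by move/poch_definedP : mh; apply.
  have jE : i%:R = - m%:~R + `|(i%:Z + m)%R|%N%:R :> R[i].
    by rewrite !pmulrn -rmorphN -rmorphD; congr (_%:~R); lia.
  rewrite jE opprD opprK addrA.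
  by move/poch_definedP : rh; apply; rewrite ?NegzE; lia.
have := poch_step hd; have -> : m - s.+2%:Z + 1 = m + Negz s by rewrite NegzE; lia.
rewrite IH// => E.
apply: (mulIf h2); rewrite -E -mulrA; congr (_ * _).
have -> : x + (m - s.+2%:Z)%:~R = x + m%:~R - s.+2%:R by rewrite rmorphB/= addrA.
by rewrite -NegzE /poch [in RHS]big_nat_recr//= invfM -mulrA mulVf ?mulr1.
Qed.

Lemma poch_nat_reflection (R : realType) (x : R[i]) (m : nat) :
  poch (1 - x - m%:R) m = (-1) ^+ m * poch x m.
Proof.
have -> : 1 - x - m%:R = 1 - (x + m%:R) by ring.
rewrite -[X in poch _ X = _](opprK (Posz m)) poch_reflection abszN absz_nat.
have -> : poch (x + m%:R) (- m%:Z) = (poch x m)^-1; last by rewrite invrK.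
case: m => [|m]; first by rewrite !poch_posE !big_geq// invr1.
rewrite -NegzE /poch; congr (_^-1); rewrite big_add1 /= !big_mkord.
rewrite (reindex_inj rev_ord_inj)/=; apply: eq_bigr => i _.
rewrite -addrA -natrB; have im := ltn_ord i; last by lia.
by congr (_ + _%:R); lia.
Qed.

(** Raising [s] by one appends a block of [n] factors, [c + n s + i = n ((c + i) / n + s)]. *)
Lemma poch_multiplication (R : realType) (c : R[i]) (n s : nat) : (0 < n)%N ->
  poch c (n * s)%N = n%:R ^+ (n * s) * \prod_(0 <= i < n) poch ((c + i%:R) / n%:R) s.
Proof.
move=> n0; have nC : n%:R != 0 :> R[i] by rewrite pnatr_eq0 -lt0n.
elim: s => [|s IH].
  rewrite muln0 expr0 mul1r poch_posE big_geq// big1// => i _.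
  by rewrite poch_posE big_geq.
rewrite mulnS addnC [LHS](_ : _ = poch c (n * s)%N * poch (c + (n * s)%:R) n); last first.
  elim: n {n0 nC IH} (n * s)%N => [|n IH] m.
    by rewrite addn0 [X in _ * X]poch_posE big_geq ?mulr1.
  by rewrite addnS !poch_recr IH natrD -!mulrA addrA.
rewrite IH exprD -!mulrA; congr (_ * _).
under [in RHS]eq_bigr do rewrite poch_recr.
rewrite big_split/= mulrCA; congr (_ * _).
rewrite -[X in n%:R ^+ X]subn0 -prodr_const_nat -big_split/=.
apply: eq_bigr => i _; rewrite natrM; field; exact: nC.
Qed.

Lemma poch_fact (R : realType) (k m : nat) :
  poch (k.+1%:R : R[i]) m * k`!%:R = (k + m)`!%:R.
Proof.
elim: m => [|m IH]; first by rewrite poch_posE big_geq// mul1r addn0.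
by rewrite poch_recr mulrAC IH addnS factS natrM -natrD addSn mulrC.
Qed.

(* The coefficient [C(A + B k, k) f_k] of the paper is [U_k / (k! (A + 1)_(ell - 1))]
   with [U_k] as below, for [A = - a]. *)
Definition gould_poch (R : realType) (ell : int) (a D : R[i]) (k : nat) : R[i] :=
  poch (1 - (a + D * k%:R)) (k%:Z + ell - 1).

Lemma gould_poch_defined (R : realType) (ell : int) (a B : R[i]) k :
  poch_defined (- a + B * k%:R + 1) (ell - 1) ->
  poch_defined (1 - (a + (1 - B) * k%:R)) (k%:Z + ell - 1).
Proof.
move=> /poch_definedP h; apply/poch_definedP => i i0 ik.
have := h (i + k)%N; rewrite addn_gt0 i0 => /(_ isT) => hh.
have -> : 1 - (a + (1 - B) * k%:R) - i%:R = - a + B * k%:R + 1 - (i + k)%:R.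
  by rewrite natrD; ring.
by apply: hh; lia.
Qed.

(** The Pochhammer symbol in [f_coef] starts exactly where the one in [cbin] ends, so the two merge
    into one. *)
Lemma gould_coefE (R : realType) (ell : int) (a B : R[i]) k :
  poch_defined (- a + B * k%:R + 1) (ell - 1) ->
  cbin (- a + B * k%:R) k * f_coef ell (- a) B k =
  gould_poch ell a (1 - B) k / (k`!%:R * poch (1 - a) (ell - 1)).
Proof.
move=> h; rewrite /f_coef /cbin /gould_poch.
have -> : k%:Z + ell - 1 = k%:Z + (ell - 1) by rewrite addrA.
have e : - a + B * k%:R + 1 = 1 - (a + (1 - B) * k%:R) + k%:~R by rewrite -pmulrn; ring.
have e2 : - a + B * k%:R - k%:R + 1 = 1 - (a + (1 - B) * k%:R) by ring.
have e3 : - a + 1 = 1 - a by ring.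
rewrite e in h; have hk : poch_defined (1 - (a + (1 - B) * k%:R)) k by [].
rewrite (poch_add hk h) -e e2 e3 invfM.
by rewrite mulrACA.
Qed.

Lemma sign_abszB (R : realType) (m : int) (k : nat) :
  (-1) ^+ `|m - k%:Z|%N = (-1) ^+ `|m|%N * (-1) ^+ k :> R[i].
Proof.
have -> : (-1) ^+ `|m - k%:Z|%N = (-1) ^+ (`|m| + k)%N :> R[i].
  by rewrite -signr_odd -[RHS]signr_odd; congr (_ ^+ nat_of_bool _); lia.
by rewrite exprD.
Qed.

(** At [k = kappa], the reciprocal of the right-hand side is the prefactor of the theorem, apart
    from the power of the constant [K]. *)
Lemma gould_coef_prefactor (R : realType) (ell : int) (a D : R[i]) k :
  gould_poch ell a D k / (k`!%:R * poch (1 - a) (ell - 1)) =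
  (-1) ^+ k * poch a (1 - ell) / (k`!%:R * poch (a + D * k%:R) (1 - ell - k%:Z)).
Proof.
rewrite /gould_poch.
have -> : k%:Z + ell - 1 = - (1 - ell - k%:Z) by lia.
have -> : ell - 1 = - (1 - ell) by lia.
rewrite !poch_reflection sign_abszB.
have s0 : (-1) ^+ `|(1 - ell)%R|%N != 0 :> R[i] by rewrite expf_neq0// oppr_eq0 oner_eq0.
rewrite !invfM !invrK; move: s0.
move: ((-1) ^+ `|(1 - ell)%R|%N : R[i]) => s s0.
move: (poch _ _)^-1 (poch a _) (k`!%:R^-1) => x y z.
by field.
Qed.

(* One term of the hypergeometric series at [0] is one term of residue [kappa]
   mod [q] of the binomial series. *)
Lemma gould_poch_zero (R : realType) (ell : int) (a : R[i]) (p q kappa s : nat)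
    (c := a + (p + q)%:R / q%:R * kappa%:R)
    (d := a - ell%:~R + 1 + p%:R * kappa%:R / q%:R) : (0 < q)%N ->
  (forall k, poch_defined (1 - (a + (p + q)%:R / q%:R * k%:R)) (k%:Z + ell - 1)) ->
  gould_poch ell a ((p + q)%:R / q%:R) (kappa + q * s) * poch d (p * s)%N =
  (-1) ^+ (q * s) * poch c ((p + q) * s)%N *
  gould_poch ell a ((p + q)%:R / q%:R) kappa.
Proof.
move=> q0 hdef; have qC : q%:R != 0 :> R[i] by rewrite pnatr_eq0 -lt0n.
set D := (p + q)%:R / q%:R in c hdef *; rewrite /gould_poch.
have cE : a + D * (kappa + q * s)%:R = c + ((p + q) * s)%:R.
  by rewrite /c /D natrD !natrM; field.
have h1 := hdef (kappa + q * s)%N; rewrite cE in h1 *.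
have h0 := hdef kappa; rewrite -/c in h0 *.
set N0 := kappa%:Z + ell - 1 in h0 *.
have N0E : (kappa + q * s)%N%:Z + ell - 1 = N0 + (q * s)%N%:Z by rewrite /N0; lia.
rewrite N0E in h1 *.
have e1 : 1 - (c + ((p + q) * s)%:R) = 1 - c - ((p + q) * s)%:R by ring.
have dE : 1 - c - ((p + q) * s)%:R + (N0 + (q * s)%N%:Z)%:~R = 1 - d - (p * s)%:R.
  rewrite /N0 /c /d /D !rmorphD rmorphN/= -!pmulrn mulnDl !natrD; field; exact: qC.
(* The symbol of order [(p + q) s + N0] based at [1 - c - (p + q) s] is split in two ways, as
   [(N0 + q s) + p s] and as [(p + q) s + N0]; reflection then restores [c] and [d]. *)
have := poch_add (r := (p * s)%N%:Z) h1 I; rewrite e1 dE.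
have -> : N0 + (q * s)%N%:Z + (p * s)%N%:Z = ((p + q) * s)%N%:Z + N0 by lia.
have e2 : 1 - c - ((p + q) * s)%:R + ((p + q) * s)%N%:Z%:~R = 1 - c.
  by rewrite -pmulrn subrK.
rewrite poch_add; [|by []|by rewrite e2].
rewrite e2 poch_nat_reflection -[poch (1 - d - _) _]/(poch _ (p * s)%N).
rewrite poch_nat_reflection => E.
have sg : (-1) ^+ (p * s) * (-1) ^+ (p * s) = 1 :> R[i].
  by rewrite -expr2 sqrr_sign.
rewrite -[LHS]mul1r -[X in X * _ = _]sg.
transitivity ((-1) ^+ (p * s) * (poch (1 - c - ((p + q) * s)%:R) (N0 + (q * s)%N%:Z) *
  ((-1) ^+ (p * s) * poch d (p * s)%N))); first by ring.
rewrite -E mulnDl exprD.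
transitivity ((-1) ^+ (p * s) * (-1) ^+ (p * s) * ((-1) ^+ (q * s) *
  poch c (p * s + q * s)%N * poch (1 - c) N0)); first by ring.
by rewrite sg mul1r.
Qed.

(** The symbol on the left splits into consecutive blocks of orders [q s], [N0] and [p s]. The first
    reflects to [(c)_(q s)], the second is the value at [kappa], and the third starts at [d]. *)
Lemma gould_poch_infty (R : realType) (ell : int) (a : R[i]) (p q kappa s : nat)
    (c := a + q%:R / (p + q)%:R * kappa%:R)
    (d := - a + ell%:~R + p%:R * kappa%:R / (p + q)%:R) : (0 < q)%N ->
  (forall k, poch_defined (1 - (a + q%:R / (p + q)%:R * k%:R)) (k%:Z + ell - 1)) ->
  gould_poch ell a (q%:R / (p + q)%:R) (kappa + (p + q) * s) =
  (-1) ^+ (q * s) * poch c (q * s)%N * poch d (p * s)%N *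
  gould_poch ell a (q%:R / (p + q)%:R) kappa.
Proof.
move=> q0 hdef.
have nC : (p + q)%:R != 0 :> R[i] by rewrite pnatr_eq0 -lt0n addn_gt0 q0 orbT.
set D := q%:R / (p + q)%:R in c hdef *; rewrite /gould_poch.
have cE : a + D * (kappa + (p + q) * s)%:R = c + (q * s)%:R.
  by rewrite /c /D natrD !natrM; field; rewrite -natrD.
have h0 := hdef kappa; rewrite -/c cE in h0 *.
set N0 := kappa%:Z + ell - 1 in h0 *.
have -> : (kappa + (p + q) * s)%N%:Z + ell - 1 = (q * s)%N%:Z + (N0 + (p * s)%N%:Z).
  by rewrite /N0; lia.
have -> : 1 - (c + (q * s)%:R) = 1 - c - (q * s)%:R by ring.
have e2 : 1 - c - (q * s)%:R + (q * s)%N%:Z%:~R = 1 - c.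
  by rewrite -pmulrn subrK.
have dE : 1 - c + N0%:~R = d.
  rewrite /N0 /c /d /D !rmorphD rmorphN/= -!pmulrn.
  by field; rewrite -natrD.
rewrite poch_add; [|by []|by rewrite e2; apply: poch_defined_le h0; lia].
rewrite e2 poch_nat_reflection poch_add// dE; ring.
Qed.

(** * Arithmetic sections and hypergeometric terms *)

(** The partial sums of the section are those of [u] at the multiples of [N]. *)
Lemma has_sum_section (R : realType) (N kappa : nat) (u : nat -> R[i]) (S : R[i]) :
  (kappa < N)%N -> (forall k, k != kappa %[mod N] -> u k = 0) ->
  has_sum u S -> has_sum (fun s => u (kappa + N * s)%N) S.
Proof.
move=> kN u0; have N0 : (0 < N)%N by exact: leq_ltn_trans kN.
have block n : \sum_(0 <= s < n) u (kappa + N * s)%N = \sum_(0 <= k < N * n) u k.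
  elim: n => [|n IH]; first by rewrite muln0 !big_geq.
  rewrite big_nat_recr//= IH mulnS [(N + _)%N]addnC.
  rewrite [RHS](@big_cat_nat _ _ _ (N * n)%N 0%N)//= ?leq_addr//.
  congr (_ + _); rewrite -{2}[(N * n)%N]add0n big_addn addKn.
  rewrite big_mkord (bigD1 (Ordinal kN))//= big1 ?addr0// => i ik.
  apply: u0; rewrite addnC mulnC modnMDl modn_small//.
  by rewrite modn_small//; move: ik; rewrite -val_eqE.
move=> /has_sumP/cvgrPdist_lt us; apply/has_sumP/cvgrPdist_lt => e e0.
have [m _ hm] := us e e0; exists m => //= n mn.
rewrite block; apply: hm => /=; apply: leq_trans mn _.
by rewrite leq_pmull.
Qed.

Lemma sum_root_of_unity (R : realType) (N : nat) (om : R[i]) (k kappa : nat) :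
  N.-primitive_root om ->
  \sum_(j < N) om^-1 ^+ (j * kappa) * (om ^+ j) ^+ k =
  if k == kappa %[mod N] then N%:R else 0.
Proof.
move=> pr; have om0 : om != 0.
  apply: contra_eq_neq (prim_expr_order pr) => ->.
  by rewrite expr0n gtn_eqF ?(prim_order_gt0 pr)// eq_sym oner_eq0.
set z := om ^+ k / om ^+ kappa.
have -> : \sum_(j < N) om^-1 ^+ (j * kappa) * (om ^+ j) ^+ k = \sum_(j < N) z ^+ j.
  apply: eq_bigr => j _; rewrite /z expr_div_n exprVn mulrC -!exprM.
  by rewrite [(j * k)%N]mulnC [(j * kappa)%N]mulnC.
have zN : z ^+ N = 1.
  by rewrite /z expr_div_n -!exprM mulnC exprM (prim_expr_order pr) expr1n
    mulnC exprM (prim_expr_order pr) expr1n divr1.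
case: ifPn => [e|ne].
  have z1 : z = 1.
    move: e; rewrite -(eq_prim_root_expr pr) => /eqP e.
    by rewrite /z e divff// expf_neq0.
  rewrite z1 (eq_bigr (fun=> 1)) ?sumr_const ?card_ord// => j _.
  by rewrite expr1n.
have z1 : z - 1 != 0.
  rewrite subr_eq0; apply: contra ne; rewrite -(eq_prim_root_expr pr) => /eqP e.
  have oK : om ^+ kappa != 0 by rewrite expf_neq0.
  by rewrite -[om ^+ k](divfK oK) -/z e mul1r.
by apply: (mulfI z1); rewrite -subrX1 zN subrr mulr0.
Qed.

Lemma eps_exp (R : realType) r i :
  eps R r ^+ i = cexp (0 +i* (2 * pi * i%:R / r%:R)).
Proof.
rewrite /eps -cexpMn natrC; congr cexp; simpc.
by congr (_ +i* _); ring.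
Qed.

Lemma eps_primitive (R : realType) (N : nat) : (0 < N)%N ->
  N.-primitive_root (eps R N).
Proof.
move=> N0; have NR : 0 < N%:R :> R by rewrite ltr0n.
have cexpE (y : R) : cexp (0 +i* y) = cos y +i* sin y.
  by rewrite /cexp /= expR0 mul1r.
apply/andP; split=> //; apply/forallP => i; rewrite unity_rootE eps_exp cexpE.
have [->|iN] := eqVneq i.+1 N.
  have -> : 2 * pi * N%:R / N%:R = pi *+ 2 :> R by field; rewrite gt_eqF.
  by rewrite cos2pi sin2pi eqxx.
have iN' : (i.+1 < N)%N by rewrite ltn_neqAle iN ltn_ord.
(* If a lower power were 1, then [cos x = 1 - 2 sin(x / 2)^2] would force [sin(x / 2) = 0], although
   [x / 2] lies strictly between 0 and pi. *)
apply/eqP/negP => /eqP[c1 _].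
set x := 2 * pi * i.+1%:R / N%:R in c1.
have : 0 < sin (x / 2).
  have -> : x / 2 = pi * (i.+1%:R / N%:R) by rewrite /x; field; rewrite gt_eqF.
  apply: sin_gt0_pi; rewrite mulr_gt0 ?pi_gt0 ?divr_gt0 ?ltr0n//=.
  by rewrite gtr_pMr ?pi_gt0// ltr_pdivrMr// mul1r ltr_nat.
have xE : x = (x / 2) *+ 2 by rewrite -mulr_natr divfK.
move: c1; rewrite xE cos_mulr2n cos2sin2 -xE => c1 s0.
have : sin (x / 2) ^+ 2 = 0 by move: c1; move: (sin (x / 2) ^+ 2) => t; lra.
by move/eqP; rewrite expf_eq0/= gt_eqF.
Qed.

(* Averaging over the [N] roots extracts the terms of residue [kappa]. *)
Lemma has_sum_residue (R : realType) (N kappa : nat) (om t : R[i])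
    (T : nat -> R[i]) (V : 'I_N -> R[i]) :
  N.-primitive_root om -> (kappa < N)%N ->
  (forall j : 'I_N, has_sum (fun k => T k * (om ^+ j * t) ^+ k) (V j)) ->
  has_sum (fun s => T (kappa + N * s)%N * t ^+ (kappa + N * s))
    (N%:R^-1 * \sum_(j < N) om^-1 ^+ (j * kappa) * V j).
Proof.
move=> pr kN hV; have N0 : N%:R != 0 :> R[i].
  by rewrite pnatr_eq0 -lt0n (prim_order_gt0 pr).
have h := has_sumZ (c := N%:R^-1)
  (has_sum_bigsum (r := index_enum 'I_N) (fun j => has_sumZ (c := om^-1 ^+ (j * kappa)) (hV j))).
pose u k := if k == kappa %[mod N] then T k * t ^+ k else 0.
have hu : has_sum u (N%:R^-1 * \sum_(j < N) om^-1 ^+ (j * kappa) * V j).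
  refine (has_sum_eq h _) => k /=; rewrite /u.
  transitivity (N%:R^-1 * ((\sum_(j < N) om^-1 ^+ (j * kappa) * (om ^+ j) ^+ k) * (T k * t ^+ k))).
    rewrite big_distrl/=; congr (_ * _); apply: eq_bigr => j _.
    by rewrite exprMn; ring.
  rewrite (sum_root_of_unity _ _ pr); case: ifP => _; last by rewrite mul0r mulr0.
  by rewrite mulKf.
have := has_sum_section kN _ hu.
move=> /(_ _)h'; refine (has_sum_eq (h' _) _).
  by move=> k; rewrite /u => /negPf ->.
by move=> s; rewrite /u [(kappa + _)%N]addnC mulnC modnMDl eqxx addnC.
Qed.

Lemma hypF_residue (R : realType) (N kappa : nat) (om t z : R[i])
    (us bs : seq R[i]) (T : nat -> R[i]) (V : 'I_N -> R[i]) :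
  N.-primitive_root om -> (kappa < N)%N -> T kappa != 0 ->
  (forall j : 'I_N, has_sum (fun k => T k * (om ^+ j * t) ^+ k) (V j)) ->
  (forall s, T kappa * hyp_term us bs z s = T (kappa + N * s)%N * (t ^+ N) ^+ s) ->
  csummable (hyp_term us bs z) /\
  t ^+ kappa * hypF us bs z =
    (T kappa)^-1 * (N%:R^-1 * \sum_(j < N) om^-1 ^+ (j * kappa) * V j).
Proof.
move=> pr kN Tk hV hT; have N0 := prim_order_gt0 pr.
have hS := has_sum_residue pr kN hV; set S := _ * \sum_(j < N) _ in hS *.
have [H hH] : exists H, has_sum (hyp_term us bs z) H.
  (* At [t = 0] one cannot divide by [t^kappa], but there the hypergeometric series stops after its
     first term. *)
  have [t0|t0] := eqVneq t 0.
    exists (\sum_(0 <= k < 1) hyp_term us bs z k); apply: has_sum_finite => -[//|k] _.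
    by apply: (mulfI Tk); rewrite hT t0 mulr0 expr0n gtn_eqF// expr0n mulr0.
  exists ((T kappa)^-1 * t ^- kappa * S).
  refine (has_sum_eq (has_sumZ (c := (T kappa)^-1 * t ^- kappa) hS) _) => s.
  apply: (mulfI Tk); rewrite hT exprD exprM.
  have tk : t ^+ kappa != 0 by rewrite expf_neq0.
  by move: (t ^+ kappa) tk (T kappa) Tk => x x0 y y0; field; rewrite x0 y0.
split; first exact: has_sum_csummable hH.
rewrite /hypF (has_sum_csum hH); apply: (mulfI Tk); rewrite [RHS]mulVKf//.
have h1 := has_sumZ (c := T kappa * t ^+ kappa) hH; rewrite mulrA.
apply: has_sum_unique h1 _; refine (has_sum_eq hS _) => s.
by rewrite mulrAC hT exprD exprM; ring.
Qed.

Lemma prod_iota0 (R : realType) (F : nat -> R[i]) n :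
  \prod_(i <- iota 0 n) F i = \prod_(0 <= i < n) F i.
Proof. by rewrite /index_iota subn0. Qed.

Lemma prod_iota1 (R : realType) (F : nat -> R[i]) n :
  \prod_(i <- iota 1 n) F i = \prod_(0 <= i < n) F i.+1.
Proof. by rewrite -(big_add1 _ _ 0 n.+1 xpredT F) /index_iota subn1. Qed.

Lemma poch_1 (R : realType) (m : nat) : poch (1 : R[i]) m = m`!%:R.
Proof. by have := poch_fact R 0 m; rewrite fact0 mulr1 add0n. Qed.

(* The parameter omitted from the list is the one equal to [1]. *)
Lemma prod_poch_omitted (R : realType) (N kappa s : nat) : (kappa < N)%N ->
  (\prod_(b <- [seq i%:R / N%:R + kappa%:R / N%:R
                 | i <- [seq i <- iota 1 N | i != (N - kappa)%N]]) poch (b : R[i]) s)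
    * poch 1 s =
  (kappa + N * s)`!%:R / (kappa`!%:R * N%:R ^+ (N * s)).
Proof.
move=> kN; have N0 : (0 < N)%N by exact: leq_ltn_trans kN.
have NC : N%:R != 0 :> R[i] by rewrite pnatr_eq0 -lt0n.
rewrite big_map big_filter.
have one : ((N - kappa)%:R / N%:R + kappa%:R / N%:R : R[i]) = 1.
  by rewrite -mulrDl -natrD subnK ?divff// ltnW.
have D : \prod_(i <- iota 1 N) poch (i%:R / N%:R + kappa%:R / N%:R : R[i]) s =
    poch 1 s * \prod_(i <- iota 1 N | i != (N - kappa)%N)
      poch (i%:R / N%:R + kappa%:R / N%:R) s.
  by rewrite (bigD1_seq (N - kappa)%N)/= ?one ?iota_uniq// mem_iota; lia.
rewrite mulrC -D.
rewrite prod_iota1.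
have := poch_multiplication (kappa.+1%:R : R[i]) s N0.
have -> : \prod_(0 <= i < N) poch (i.+1%:R / N%:R + kappa%:R / N%:R : R[i]) s =
    \prod_(0 <= i < N) poch ((kappa.+1%:R + i%:R) / N%:R : R[i]) s.
  by apply: eq_bigr => i _; congr poch; rewrite -mulrDl -!natrD; congr (_%:R / _); lia.
move=> h; have f0 : kappa`!%:R != 0 :> R[i] by rewrite pnatr_eq0 -lt0n fact_gt0.
rewrite -poch_fact h.
have Ns : N%:R ^+ (N * s) != 0 :> R[i] by rewrite expf_neq0.
by move: (N%:R ^+ (N * s)) (kappa`!%:R) Ns f0 => x y x0 y0; field; rewrite x0 y0.
Qed.

Lemma prod_poch_shift (R : realType) (c e : R[i]) (n s : nat) : (0 < n)%N ->
  \prod_(0 <= i < n) poch ((c + i%:R) / n%:R + e) s =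
  poch (c + n%:R * e) (n * s)%N / n%:R ^+ (n * s).
Proof.
move=> n0; have nC : n%:R != 0 :> R[i] by rewrite pnatr_eq0 -lt0n.
rewrite poch_multiplication// mulrC mulKf ?expf_neq0//.
by apply: eq_bigr => i _; congr poch; field.
Qed.

Lemma hyp_term_zero (R : realType) (p q kappa s : nat) ell (a z : R[i]) :
  (0 < p)%N -> (kappa < q)%N ->
  hyp_term (upper_zero p q a kappa) (lower_zero p q ell a kappa) z s =
  (poch (a + (p + q)%:R / q%:R * kappa%:R) ((p + q) * s)%N / (p + q)%:R ^+ ((p + q) * s)) /
  ((poch (a - ell%:~R + 1 + p%:R * kappa%:R / q%:R) (p * s)%N / p%:R ^+ (p * s)) *
   ((kappa + q * s)`!%:R / (kappa`!%:R * q%:R ^+ (q * s)))) * z ^+ s.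
Proof.
move=> p0 kq; have n0 : (0 < p + q)%N by rewrite addn_gt0 p0.
have q0 : (0 < q)%N by exact: leq_ltn_trans kq.
have qC : q%:R != 0 :> R[i] by rewrite pnatr_eq0 -lt0n.
rewrite /hyp_term /upper_zero big_map prod_iota0 prod_poch_shift//.
rewrite /lower_zero big_cat big_map prod_iota1 -[_ * _ * poch 1 s]mulrA prod_poch_omitted//.
congr (poch _ _ / _ / (_ * _) * _); first by ring.
rewrite -[_ / p%:R ^+ _](_ :
  poch (a - ell%:~R + 1 + p%:R * (kappa%:R / q%:R)) (p * s)%N / p%:R ^+ (p * s) = _);
  last first.
  by congr (poch _ _ / _); ring.
rewrite -prod_poch_shift//; apply: eq_bigr => i _; congr (poch (_ / _ + _) _).
by rewrite -natr1; ring.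
Qed.

Lemma hyp_term_infty (R : realType) (p q kappa s : nat) ell (a z : R[i]) :
  (0 < p)%N -> (0 < q)%N -> (kappa < p + q)%N ->
  hyp_term (upper_infty p q ell a kappa) (lower_infty R p q kappa) z s =
  (poch (- a + ell%:~R + p%:R * kappa%:R / (p + q)%:R) (p * s)%N / p%:R ^+ (p * s)) *
  (poch (a + q%:R / (p + q)%:R * kappa%:R) (q * s)%N / q%:R ^+ (q * s)) /
   ((kappa + (p + q) * s)`!%:R / (kappa`!%:R * (p + q)%:R ^+ ((p + q) * s))) * z ^+ s.
Proof.
move=> p0 q0 kn.
rewrite /hyp_term /upper_infty big_cat/= 2!big_map.
rewrite (prod_iota0 _ p) (prod_iota0 _ q) prod_poch_shift// prod_poch_shift//.
rewrite /lower_infty prod_poch_omitted//.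
have -> : p%:R * (kappa%:R / (p + q)%:R) = p%:R * kappa%:R / (p + q)%:R :> R[i].
  by rewrite mulrA.
have -> // : q%:R * (kappa%:R / (p + q)%:R) = q%:R / (p + q)%:R * kappa%:R :> R[i].
by rewrite mulrCA mulrC.
Qed.

(** * Roots of the trinomial near 1 *)

Lemma cabs_mixed_le (R : realType) (u v : R[i]) (r : R) i j :
  r <= 1 -> cabs (u - 1) <= r -> cabs (v - 1) <= r ->
  cabs (u ^+ i * v ^+ j - 1) <= (2 ^+ (i + j) - 1) * r.
Proof.
move=> r1 ur vr.
have step (x y : R[i]) k : cabs (x - 1) <= r -> cabs (y - 1) <= (2 ^+ k - 1) * r ->
    cabs (x * y - 1) <= (2 ^+ k.+1 - 1) * r.
  move=> xr yr; have -> : x * y - 1 = x * (y - 1) + (x - 1) by ring.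
  apply: le_trans (ler_cabsD _ _) _; rewrite cabsM exprS.
  have x2 : cabs x <= 2 by have := ler_cabsD (x - 1) 1; rewrite subrK cabs1; lra.
  have := @ler_pM _ _ _ _ _ (cabs_ge0 x) (cabs_ge0 (y - 1)) x2 yr.
  by lra.
elim: i => [|i IH]; last by rewrite exprS -mulrA addSn; exact: step.
rewrite expr0 mul1r add0n; elim: j => [|j IH]; last by rewrite exprS; exact: step.
by rewrite !expr0 !subrr mul0r cabs0.
Qed.

Lemma cabs_diffquot_le (R : realType) (u v : R[i]) (r : R) n : r <= 1 ->
  cabs (u - 1) <= r -> cabs (v - 1) <= r ->
  cabs ((\sum_(i < n) u ^+ (n.-1 - i) * v ^+ i) - n%:R) <= n%:R * 2 ^+ n * r.
Proof.
move=> r1 ur vr; have r0 : 0 <= r by apply: le_trans ur; exact: cabs_ge0.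
have -> : n%:R = \sum_(i < n) 1 :> R[i] by rewrite sumr_const card_ord.
rewrite -sumrB; apply: le_trans (ler_cabs_sum _ _ _) _.
apply: (@le_trans _ _ (\sum_(i < n) 2 ^+ n * r)); last first.
  by rewrite sumr_const card_ord -[leLHS]mulr_natl mulrA.
apply: ler_sum => i _; apply: le_trans (cabs_mixed_le _ _ r1 ur vr) _.
apply: ler_wpM2r => //; rewrite lerBlDr (@le_trans _ _ (2 ^+ n))//; last first.
  by rewrite lerDl.
by apply: ler_weXn2l; rewrite ?ler1n//; have := ltn_ord i; lia.
Qed.

(** Two roots satisfy [(u - v) (hn - G hp) = 0] with [hn], [hp] the difference quotients of the two
    powers. Near 1 the second factor is close to [n - p G0], of modulus at least 1. The radius is
    uniform in [G] near [G0] and in [B]. *)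
Lemma trinomial_root_uniq (R : realType) (p q : nat) (G0 : R[i]) :
  cabs G0 <= 1 -> 1 <= cabs ((p + q)%:R - p%:R * G0) ->
  exists2 r : R, 0 < r & forall G B u v : R[i], cabs (G - G0) < r ->
    cabs (u - 1) <= r -> cabs (v - 1) <= r ->
    trinomial_root p q G B u -> trinomial_root p q G B v -> u = v.
Proof.
move=> G01 big; pose n := (p + q)%N.
pose M : R := n.+1%:R * 2 ^+ n.
have M0 : 0 < M by rewrite mulr_gt0 ?exprn_gt0 ?ltr0n.
have M1 : 1 <= M by rewrite mulr_ege1 ?exprn_ege1 ?ler1n.
(* The three error terms are then at most 1/8, 2/8 and 1/8, in total less than 1. *)
pose r := (8 * M)^-1; have r0 : 0 < r by rewrite invr_gt0 mulr_gt0.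
have rM : M * r = 8^-1 by rewrite /r; field; rewrite gt_eqF.
have r1 : r <= 1 by nra.
exists r => // G B u v Gr ur vr; rewrite /trinomial_root -/n => eu ev.
have : (u ^+ n - v ^+ n) - G * (u ^+ p - v ^+ p) = 0.
  transitivity ((u ^+ n - G * u ^+ p - B) - (v ^+ n - G * v ^+ p - B)); first by ring.
  by rewrite eu ev subrr.
rewrite !subrXX; set hn := \sum_(i < n) _; set hp := \sum_(i < p) _ => e.
have : (u - v) * (hn - G * hp) = 0 by rewrite -[RHS]e; ring.
move/eqP; rewrite mulf_eq0 subr_eq0 => /orP[/eqP //|/eqP h0]; exfalso.
have bn : cabs (hn - n%:R) <= M * r.
  apply: le_trans (cabs_diffquot_le _ r1 ur vr) _.
  apply: ler_wpM2r; first exact: ltW.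
  by apply: ler_wpM2r; [exact: exprn_ge0|rewrite ler_nat].
have bp : cabs (hp - p%:R) <= M * r.
  apply: le_trans (cabs_diffquot_le _ r1 ur vr) _.
  apply: ler_wpM2r; first exact: ltW.
  apply: ler_pM; rewrite ?exprn_ge0// ?ler_nat; first by rewrite leqW// leq_addr.
  by apply: ler_weXn2l; rewrite ?ler1n// /n leq_addr.
have G2 : cabs G <= 2 by have := ler_cabsD (G - G0) G0; rewrite subrK; nra.
have pM : p%:R <= M.
  apply: (@le_trans _ _ n.+1%:R); first by rewrite ler_nat leqW// leq_addr.
  by rewrite ler_peMr// exprn_ege1// ler1n.
have E : n%:R - p%:R * G0 = (hn - G * hp) -
    ((hn - n%:R) - (G * (hp - p%:R) + (G - G0) * p%:R)) by ring.
have := big; rewrite -/n E h0 sub0r cabsN.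
have h1 := ler_cabsB (hn - n%:R) (G * (hp - p%:R) + (G - G0) * p%:R).
have h2 := ler_cabsD (G * (hp - p%:R)) ((G - G0) * p%:R).
have h3 : cabs (G * (hp - p%:R)) <= 2 * (M * r).
  by rewrite cabsM; apply: ler_pM; rewrite ?cabs_ge0.
have h4 : cabs ((G - G0) * p%:R) <= r * M.
  by rewrite cabsM cabs_nat; apply: ler_pM; [exact: cabs_ge0|exact: ler0n|exact: ltW|].
rewrite rM in bn bp h3; rewrite [r * M]mulrC rM in h4.
lra.
Qed.

(** For monic [P], the modulus of [P.[x]] is the product of the distances from [x] to the roots; if
    all were at least [r], it would be at least [r] to the degree. *)
Lemma poly_root_near (R : realType) (P : {poly R[i]}) (x : R[i]) (r : R) :
  0 < r -> P \is monic -> cabs P.[x] < r ^+ (size P).-1 ->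
  exists2 z, root P z & cabs (z - x) < r.
Proof.
move=> r0 Pm small.
have [zs E] := closed_field_poly_normal P.
rewrite (monicP Pm) scale1r in E.
have sz : (size P).-1 = size zs by rewrite E size_prod_XsubC.
case: (pselect (exists2 z, z \in zs & cabs (z - x) < r)) => [[z zin zr]|no].
  by exists z => //; rewrite E root_prod_XsubC.
exfalso; move: small; rewrite ltNge => /negP; apply.
rewrite sz E horner_prod cabs_prod.
have far z : z \in zs -> r <= cabs (x - z).
  by move=> zin; rewrite cabsBC leNgt; apply/negP => zr; apply: no; exists z.
elim: zs far {E sz no} => [|z zs IH] far; first by rewrite expr0 big_nil.
rewrite big_cons exprS; apply: ler_pM; [exact: ltW|by rewrite exprn_ge0// ltW| |].
  by rewrite hornerXsubC far// inE eqxx.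
by apply: IH => y yin; apply: far; rewrite inE yin orbT.
Qed.

Lemma trinomial_root_exists (R : realType) (p q : nat) (G B : R[i]) (r : R) :
  (0 < q)%N -> 0 < r -> cabs (1 - G - B) < r ^+ (p + q) ->
  exists2 u, trinomial_root p q G B u & cabs (u - 1) < r.
Proof.
move=> q0 r0 small.
pose S : {poly R[i]} := - (G *: 'X ^+ p + B%:P).
have szS : (size S < (p + q).+1)%N.
  rewrite size_polyN ltnS; apply: leq_trans (size_polyD _ _) _; rewrite geq_max.
  apply/andP; split.
    by apply: leq_trans (size_scale_leq _ _) _; rewrite size_polyXn; lia.
  by apply: leq_trans (size_polyC_leq1 _) _; lia.
pose P : {poly R[i]} := 'X ^+ (p + q) + S.
have szP : size P = (p + q).+1 by rewrite size_polyDl size_polyXn.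
have Pm : P \is monic.
  by rewrite monicE lead_coefDl ?size_polyXn// lead_coefXn.
have PE y : P.[y] = y ^+ (p + q) - G * y ^+ p - B.
  by rewrite hornerD hornerN hornerD hornerZ !horner_exp !hornerX hornerC opprD addrA.
have [|z /rootP rz zr] := @poly_root_near R P 1 r r0 Pm.
  by rewrite szP PE !expr1n mulr1.
by exists z => //; rewrite /trinomial_root -PE.
Qed.

(** [G0 + B0 = 1] makes 1 a root of the limiting equation. Uniqueness fixes [r0] once and for all,
    while existence in a smaller disc forces [d] to depend on [r]. *)
Lemma trinomial_root_near1 (R : realType) (p q : nat) (G0 B0 : R[i]) :
  (0 < q)%N -> cabs G0 <= 1 -> 1 <= cabs ((p + q)%:R - p%:R * G0) -> G0 + B0 = 1 ->
  exists2 r0 : R, 0 < r0 & forall r, 0 < r -> r <= r0 ->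
    exists2 d : R, 0 < d & forall G B : R[i], cabs (G - G0) < d ->
      cabs (B - B0) < d -> exists! u, root_near p q G B 1 r u.
Proof.
move=> q0 G01 big GB; have [r0 r00 uniq] := trinomial_root_uniq G01 big.
exists r0 => // r rp rr0; have rn : 0 < r ^+ (p + q) by rewrite exprn_gt0.
exists (Num.min r0 (r ^+ (p + q) / 2)); first by rewrite lt_min r00 divr_gt0.
move=> G B; rewrite !lt_min => /andP[Gr Gn] /andP[_ Bn].
have [|u ru ur] := @trinomial_root_exists R p q G B r q0 rp.
  have -> : 1 - G - B = - ((G - G0) + (B - B0)) by rewrite -GB; ring.
  by rewrite cabsN; apply: le_lt_trans (ler_cabsD _ _) _; lra.
exists u; split; first by rewrite /root_near ltc_cabs.
move=> v [vr rv]; rewrite ltc_cabs in vr.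
by apply: (uniq G B) => //; apply: ltW; exact: lt_le_trans rr0.
Qed.

Lemma root_near_scale (R : realType) (p q : nat) (g beta c x : R[i]) (rho : R) :
  c != 0 ->
  root_near p q g beta c rho x <->
  root_near p q (g / c ^+ q) (beta / c ^+ (p + q)) 1 (rho / cabs c) (x / c).
Proof.
move=> c0; have cp : 0 < cabs c by rewrite cabs_gt0.
rewrite /root_near !ltc_cabs.
have -> : x / c - 1 = (x - c) / c by rewrite mulrBl divff.
rewrite cabsM cabsV ltr_pM2r ?invr_gt0//.
have -> : trinomial_root p q (g / c ^+ q) (beta / c ^+ (p + q)) (x / c) <->
    trinomial_root p q g beta x; last by [].
rewrite /trinomial_root.
have cn : c ^+ (p + q) != 0 by rewrite expf_neq0.
have -> : (x / c) ^+ (p + q) - g / c ^+ q * (x / c) ^+ p - beta / c ^+ (p + q) =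
    (x ^+ (p + q) - g * x ^+ p - beta) / c ^+ (p + q).
  have cq : c ^+ q != 0 by rewrite expf_neq0.
  have cp' : c ^+ p != 0 by rewrite expf_neq0.
  rewrite !expr_div_n !exprD; move: (c ^+ p) (c ^+ q) cp' cq => y z y0 z0.
  by field; rewrite y0 z0.
split=> [/eqP|->]; last by rewrite mul0r.
by rewrite mulf_eq0 invr_eq0 (negPf cn) orbF => /eqP.
Qed.

Lemma root_near_scale_uniq (R : realType) (p q : nat) (g beta c : R[i]) (rho : R) :
  c != 0 ->
  (exists! u, root_near p q (g / c ^+ q) (beta / c ^+ (p + q)) 1 (rho / cabs c) u) ->
  exists! x, root_near p q g beta c rho x.
Proof.
move=> c0 [u [ru uniq]]; exists (u * c); split.
  by apply/(root_near_scale _ _ _ _ _ _ c0); rewrite mulfK.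
move=> x /(root_near_scale _ _ _ _ _ _ c0)/uniq ->.
by rewrite divfK.
Qed.

Lemma powR_root (R : realType) (g : R) (N m : nat) : 0 < g -> (0 < N)%N ->
  [/\ 0 < g `^ N%:R^-1, (g `^ N%:R^-1) ^+ N = g,
      g `^ (- N%:R^-1) = (g `^ N%:R^-1)^-1 &
      g `^ (- (m%:R / N%:R)) = (g `^ N%:R^-1) ^- m].
Proof.
move=> g0 N0; have NR : N%:R != 0 :> R by rewrite pnatr_eq0 -lt0n.
split; first exact: powR_gt0.
- by rewrite -powR_mulrn ?powR_ge0// -powRrM mulVf// powRr1// ltW.
- by rewrite powRN.
- by rewrite powRN mulrC powRrM powR_mulrn ?powR_ge0.
Qed.

(** * The two expansions *)

(* The common part of (i) and (ii): [x_j = c_j u_j] turns the trinomial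
   equation into [(u_j^N - 1) u_j^(- N B) = om^j t]. *)
Lemma branch_sum (R : realType) (ell : int) (a B : R[i]) (N : nat) :
  f_defined ell (- a) B -> poch a (1 - ell) != 0 ->
  exists2 d : R, 0 < d & forall (om t z : R[i]) (u : 'I_N -> R[i]),
    N.-primitive_root om ->
    (forall j, cabs (u j - 1) < d) ->
    (forall j : 'I_N, (u j ^+ N - 1) * cpow (u j) (- (N%:R * B)) = om ^+ j * t) ->
    forall kappa us bs, (kappa < N)%N ->
    poch_defined (a + (1 - B) * kappa%:R) (1 - ell - kappa%:Z) ->
    (forall s, kappa`!%:R^-1 * gould_poch ell a (1 - B) kappa * hyp_term us bs z s =
       (kappa + N * s)`!%:R^-1 * gould_poch ell a (1 - B) (kappa + N * s)
         * (t ^+ N) ^+ s) ->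
    csummable (hyp_term us bs z) /\
    t ^+ kappa * hypF us bs z =
      (-1) ^+ kappa * poch 1 kappa
      * poch (a + (1 - B) * kappa%:R) (1 - ell - kappa%:Z) / poch a (1 - ell)
      * (N%:R^-1 * \sum_(j < N) om^-1 ^+ (j * kappa)
          * cpow (u j) (- N%:R * a) * F_rat ell (- a) B (u j ^+ N)).
Proof.
move=> fd a0; have [d d0 hF] := F_rat_expansion N fd; exists d => //.
move=> om t z u pr ud ut kappa us bs kN pd hT.
have [_ _ fdk] := fd.
pose T k := cbin (- a + B * k%:R) k * f_coef ell (- a) B k.
have TE k : T k = gould_poch ell a (1 - B) k / (k`!%:R * poch (1 - a) (ell - 1)).
  exact: gould_coefE.
(* A zero here would be a pole of the weight at [kappa], which [f_defined] excludes. *)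
have c0 : poch (a + (1 - B) * kappa%:R) (1 - ell - kappa%:Z) != 0.
  apply: poch_neq0 => //; have := gould_poch_defined (fdk kappa).
  by congr poch_defined; lia.
have f0 : kappa`!%:R != 0 :> R[i] by rewrite pnatr_eq0 -lt0n fact_gt0.
have s0 : (-1) ^+ kappa != 0 :> R[i] by rewrite expf_neq0// oppr_eq0 oner_eq0.
have TkE := gould_coef_prefactor ell a (1 - B) kappa; rewrite -TE in TkE.
have Tk : T kappa != 0 by rewrite TkE !mulf_neq0// invr_eq0 mulf_neq0.
have hV (j : 'I_N) : has_sum (fun k => T k * (om ^+ j * t) ^+ k)
    (cpow (u j) (N%:R * - a) * F_rat ell (- a) B (u j ^+ N)).
  by rewrite -ut; exact: hF.
have hT' s : T kappa * hyp_term us bs z s = T (kappa + N * s)%N * (t ^+ N) ^+ s.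
  rewrite !TE !invfM.
  transitivity ((poch (1 - a) (ell - 1))^-1 *
    (kappa`!%:R^-1 * gould_poch ell a (1 - B) kappa * hyp_term us bs z s)).
    by ring.
  by rewrite hT; ring.
have [sm E] := hypF_residue pr kN Tk hV hT'; split=> //; rewrite E TkE poch_1.
have -> : \sum_(j < N) om^-1 ^+ (j * kappa) *
    (cpow (u j) (N%:R * - a) * F_rat ell (- a) B (u j ^+ N)) =
  \sum_(j < N) om^-1 ^+ (j * kappa) * cpow (u j) (- N%:R * a) *
    F_rat ell (- a) B (u j ^+ N).
  by apply: eq_bigr => j _; rewrite mulrA mulrN mulNr.
by congr (_ * _); rewrite !invfM !invrK invr_sign; ring.
Qed.

Lemma gould_hyp_zero (R : realType) (ell : int) (a t : R[i]) (p q kappa s : nat)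
    (K := (-1) ^+ q * (p + q)%:R ^+ (p + q) / (p%:R ^+ p * q%:R ^+ q) : R[i]) :
  (0 < p)%N -> (kappa < q)%N ->
  (forall k, poch_defined (1 - (a + (p + q)%:R / q%:R * k%:R)) (k%:Z + ell - 1)) ->
  (forall b, b \in lower_zero p q ell a kappa -> ~ nonpos_int b) ->
  kappa`!%:R^-1 * gould_poch ell a ((p + q)%:R / q%:R) kappa *
    hyp_term (upper_zero p q a kappa) (lower_zero p q ell a kappa) (K * t ^+ q) s =
  (kappa + q * s)`!%:R^-1 * gould_poch ell a ((p + q)%:R / q%:R) (kappa + q * s) *
    (t ^+ q) ^+ s.
Proof.
move=> p0 kq hdef hlow; have q0 : (0 < q)%N by exact: leq_ltn_trans kq.
have GP := gould_poch_zero kappa s q0 hdef.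
rewrite hyp_term_zero//; set d := a - _ + 1 + _ in GP *.
have nz (k : nat) : (0 < k)%N -> k%:R != 0 :> R[i] by move=> k0; rewrite pnatr_eq0 -lt0n.
(* By the multiplication formula this symbol is, up to a power of [p], the product of the symbols of
   the first [p] lower parameters, none of which is a non-positive integer. *)
have d0 : poch d (p * s)%N != 0.
  have dE : d = a - ell%:~R + 1 + p%:R * (kappa%:R / q%:R) by rewrite /d mulrA.
  have : poch d (p * s)%N / p%:R ^+ (p * s) != 0.
    rewrite dE -prod_poch_shift// big_mkord; apply/prodf_neq0 => i _.
    rewrite poch_posE big_mkord; apply/prodf_neq0 => m _; apply/eqP => e.
    apply: (hlow ((a - ell%:~R + 1 + i%:R) / p%:R + kappa%:R / q%:R)).
      rewrite /lower_zero mem_cat; apply/orP; left; apply/mapP; exists i.+1.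
        by rewrite mem_iota; have := ltn_ord i; lia.
      by rewrite -natr1 [i%:R + 1]addrC !addrA.
    by exists m; apply/eqP; rewrite -subr_eq0 opprK e.
  by rewrite mulf_eq0 negb_or => /andP[].
have f1 : (kappa + q * s)`!%:R != 0 :> R[i] by apply: nz; rewrite fact_gt0.
have f0 : kappa`!%:R != 0 :> R[i] by apply: nz; rewrite fact_gt0.
have n0 : (p + q)%:R ^+ ((p + q) * s) != 0 :> R[i] by rewrite expf_neq0// nz// addn_gt0 p0.
have pp0 : p%:R ^+ (p * s) != 0 :> R[i] by rewrite expf_neq0// nz.
have qq0 : q%:R ^+ (q * s) != 0 :> R[i] by rewrite expf_neq0// nz.
have KE : (K * t ^+ q) ^+ s = (-1) ^+ (q * s) * (p + q)%:R ^+ ((p + q) * s) /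
    (p%:R ^+ (p * s) * q%:R ^+ (q * s)) * (t ^+ q) ^+ s.
  by rewrite /K exprMn expr_div_n !exprMn -!exprM.
rewrite KE; apply: (mulIf d0).
move: GP; set G0 := gould_poch _ _ _ kappa; set G1 := gould_poch _ _ _ _ => GP.
rewrite [RHS](_ : _ = (kappa + q * s)`!%:R^-1 * (G1 * poch d (p * s)%N) * (t ^+ q) ^+ s);
  last by ring.
rewrite GP; move: n0 pp0 qq0 d0 f1 f0.
move: (poch d _) ((kappa + q * s)`!%:R : R[i]) (kappa`!%:R : R[i])
  ((p + q)%:R ^+ _) (p%:R ^+ _) (q%:R ^+ _).
move=> x1 x2 x3 x4 x5 x6 n0 pp0 qq0 d0 f1 f0.
by field; rewrite n0 pp0 qq0 d0 f1 f0.
Qed.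

Lemma gould_hyp_infty (R : realType) (ell : int) (a t : R[i]) (p q kappa s : nat)
    (K := (-1) ^+ q * (p + q)%:R ^+ (p + q) / (p%:R ^+ p * q%:R ^+ q) : R[i]) :
  (0 < p)%N -> (0 < q)%N -> (kappa < p + q)%N ->
  (forall k, poch_defined (1 - (a + q%:R / (p + q)%:R * k%:R)) (k%:Z + ell - 1)) ->
  kappa`!%:R^-1 * gould_poch ell a (q%:R / (p + q)%:R) kappa *
    hyp_term (upper_infty p q ell a kappa) (lower_infty R p q kappa)
      (K^-1 * t ^+ (p + q)) s =
  (kappa + (p + q) * s)`!%:R^-1 *
    gould_poch ell a (q%:R / (p + q)%:R) (kappa + (p + q) * s) * (t ^+ (p + q)) ^+ s.
Proof.
move=> p0 q0 kn hdef; rewrite (gould_poch_infty kappa s q0 hdef) hyp_term_infty//.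
have nz (k : nat) : (0 < k)%N -> k%:R != 0 :> R[i] by move=> k0; rewrite pnatr_eq0 -lt0n.
have f1 : (kappa + (p + q) * s)`!%:R != 0 :> R[i] by apply: nz; rewrite fact_gt0.
have f0 : kappa`!%:R != 0 :> R[i] by apply: nz; rewrite fact_gt0.
have n0 : (p + q)%:R ^+ ((p + q) * s) != 0 :> R[i] by rewrite expf_neq0// nz// addn_gt0 p0.
have pp0 : p%:R ^+ (p * s) != 0 :> R[i] by rewrite expf_neq0// nz.
have qq0 : q%:R ^+ (q * s) != 0 :> R[i] by rewrite expf_neq0// nz.
have KE : (K^-1 * t ^+ (p + q)) ^+ s = (-1) ^+ (q * s) * (p%:R ^+ (p * s) * q%:R ^+ (q * s)) /
    (p + q)%:R ^+ ((p + q) * s) * (t ^+ (p + q)) ^+ s.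
  by rewrite /K !invfM !invrK invr_sign !exprMn !exprVn -!exprM; ring.
rewrite KE; move: n0 pp0 qq0 f1 f0.
move: ((kappa + (p + q) * s)`!%:R : R[i]) (kappa`!%:R : R[i])
  ((p + q)%:R ^+ ((p + q) * s)) (p%:R ^+ (p * s)) (q%:R ^+ (q * s)).
move=> x2 x3 x4 x5 x6 n0 pp0 qq0 f1 f0.
by field; rewrite n0 pp0 qq0 f1 f0.
Qed.

Lemma cabs_eps (R : realType) r : cabs (eps R r) = 1.
Proof. by rewrite /eps cabs_cexp /= expR0. Qed.

(** After rescaling by the centre [c], the small coefficient [b / c^m] becomes [om^j t], with
    [om = eps^m] and [t] independent of [j]. This is used with [m = n], [b = beta] in (i) and
    [m = q], [b = g] in (ii). *)
Lemma eps_center (R : realType) (N m j : nat) (gam : R) (b : R[i])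
    (c := eps R N ^- j * gam%:C) : (0 < N)%N -> 0 < gam ->
  [/\ c != 0, cabs c = gam, c ^+ N = (gam ^+ N)%:C,
      b / c ^+ m = (eps R N ^+ m) ^+ j * ((gam ^- m)%:C * b) &
      forall x, x / c = eps R N ^+ j * (gam^-1)%:C * x].
Proof.
move=> N0 g0; have e0 : eps R N != 0 by rewrite -cabs_eq0 cabs_eps oner_eq0.
have gC : gam%:C != 0 by rewrite -cabs_eq0 cabs_real normr_eq0 gt_eqF.
have ej k : eps R N ^+ k != 0 by rewrite expf_neq0.
split.
- by rewrite mulf_neq0// invr_eq0.
- by rewrite cabsM cabsV cabsX cabs_eps expr1n invr1 mul1r cabs_real gtr0_norm.
- rewrite exprMn exprVn -exprM mulnC exprM (prim_expr_order (eps_primitive R N0)).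
  by rewrite expr1n invr1 mul1r rmorphXn.
- rewrite exprMn exprVn invfM invrK fmorphV rmorphXn -exprM mulnC exprM; ring.
- by move=> x; rewrite invfM invrK fmorphV /=; ring.
Qed.

Lemma scaled_expr (R : realType) (gam : R) (b : R[i]) (m N : nat) :
  ((gam ^- m)%:C * b) ^+ N = b ^+ N / (gam ^+ N)%:C ^+ m.
Proof.
rewrite exprMn mulrC fmorphV !rmorphXn /= exprVn -!exprM.
by rewrite [(m * N)%N]mulnC.
Qed.

Lemma ltr_of_expr (R : realType) (x y : R) n : 0 <= y -> 0 <= x ->
  x ^+ n < y ^+ n -> x < y.
Proof.
move=> y0 x0 xy; rewrite ltNge; apply/negP => yx; move: xy.
by rewrite ltNge lerXn2r// nnegrE.
Qed.

Lemma trinomial_const_neq0 (R : realType) (p q : nat) : (0 < p)%N -> (0 < q)%N ->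
  (-1) ^+ q * (p + q)%:R ^+ (p + q) / (p%:R ^+ p * q%:R ^+ q) != 0 :> R[i].
Proof.
move=> p0 q0; rewrite !mulf_neq0 ?invr_eq0 ?mulf_neq0 ?expf_neq0 ?oppr_eq0 ?oner_eq0//.
all: by rewrite pnatr_eq0 -lt0n ?addn_gt0 ?p0.
Qed.

Lemma near1_neq0 (R : realType) (u : R[i]) : cabs (u - 1) < 1 -> u != 0.
Proof. by apply: contraTneq => ->; rewrite sub0r cabsN cabs1 ltxx. Qed.

(* The index j of the roots is shifted by one: it runs over 0, 1, ... instead
   of 1, 2, ... *)
Theorem theorem4p4 (R : realType) (p q : nat) (ell : int) (a : R[i])
    (p_ge1 : (1 <= p)%N) (q_ge1 : (1 <= q)%N) (copq : coprime p q) :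
  let n := (p + q)%N in
  let K : R[i] := (-1) ^+ q * n%:R ^+ n / (p%:R ^+ p * q%:R ^+ q) in
  (
    f_defined ell (- a) (- (p%:R / q%:R)) ->
    poch_defined a (1 - ell) ->
    poch a (1 - ell) != 0 ->
    (forall kappa : nat, (kappa < q)%N ->
       poch_defined (a + n%:R * kappa%:R / q%:R) (1 - ell - kappa%:Z)) ->
    (forall kappa : nat, (kappa < q)%N ->
       forall b, b \in lower_zero p q ell a kappa -> ~ nonpos_int b) ->
    forall g : R, 0 < g ->
    let c (j : 'I_q) : R[i] := eps R q ^- j * (g `^ (q%:R^-1))%:C in
    exists2 rho0 : R, 0 < rho0 &
    forall rho : R, 0 < rho -> rho <= rho0 ->
    exists2 delta : R, 0 < delta &
    forall zeta beta zeta_q K_q : R[i],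
      `|zeta| < delta%:C ->
      zeta = K * (beta ^+ q / g%:C ^+ n) ->
      zeta_q ^+ q = zeta ->
      K_q ^+ q = K ->
      zeta_q = K_q * (g `^ (- (n%:R / q%:R)))%:C * beta ->
      (forall j : 'I_q, exists! x : R[i], root_near p q g%:C beta (c j) rho x)
      /\
      forall x : 'I_q -> R[i],
        (forall j : 'I_q, root_near p q g%:C beta (c j) rho (x j)) ->
        forall kappa : nat, (kappa < q)%N ->
        csummable
          (hyp_term (upper_zero p q a kappa) (lower_zero p q ell a kappa) zeta)
        /\
        zeta_q ^+ kappa
          * hypF (upper_zero p q a kappa) (lower_zero p q ell a kappa) zeta
        = (-1) ^+ kappa * poch 1 kappa
          * poch (a + n%:R * kappa%:R / q%:R) (1 - ell - kappa%:Z)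
          / poch a (1 - ell)
          * K_q ^+ kappa
          * (q%:R^-1 *
             \sum_(j < q)
               (eps R q ^- n) ^+ (j * kappa)
               * cpow (eps R q ^+ j * (g `^ (- q%:R^-1))%:C * x j) (- q%:R * a)
               * F_rat ell (- a) (- (p%:R / q%:R)) (g%:C^-1 * x j ^+ q)))
  /\
  (
    f_defined ell (- a) (p%:R / n%:R) ->
    poch_defined a (1 - ell) ->
    poch a (1 - ell) != 0 ->
    (forall kappa : nat, (kappa < n)%N ->
       poch_defined (a + q%:R * kappa%:R / n%:R) (1 - ell - kappa%:Z)) ->
    forall beta : R, 0 < beta ->
    let c (j : 'I_n) : R[i] := eps R n ^- j * (beta `^ (n%:R^-1))%:C in
    exists2 rho0 : R, 0 < rho0 &
    forall rho : R, 0 < rho -> rho <= rho0 ->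
    exists2 M : R, 0 < M &
    (* zeta_n and K_n are the chosen values of zeta^(-1/n) and K^(-1/n). *)
    forall zeta g zeta_n K_n : R[i],
      M%:C < `|zeta| ->
      zeta = K * (beta%:C ^+ q / g ^+ n) ->
      zeta_n ^+ n = zeta^-1 ->
      K_n ^+ n = K^-1 ->
      zeta_n = K_n * (beta `^ (- (q%:R / n%:R)))%:C * g ->
      (forall j : 'I_n, exists! x : R[i], root_near p q g beta%:C (c j) rho x)
      /\
      forall x : 'I_n -> R[i],
        (forall j : 'I_n, root_near p q g beta%:C (c j) rho (x j)) ->
        forall kappa : nat, (kappa < n)%N ->
        csummable
          (hyp_term (upper_infty p q ell a kappa) (lower_infty R p q kappa)
             zeta^-1)
        /\
        zeta_n ^+ kappa
          * hypF (upper_infty p q ell a kappa) (lower_infty R p q kappa) zeta^-1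
        = (-1) ^+ kappa * poch 1 kappa
          * poch (a + q%:R * kappa%:R / n%:R) (1 - ell - kappa%:Z)
          / poch a (1 - ell)
          * K_n ^+ kappa
          * (n%:R^-1 *
             \sum_(j < n)
               (eps R n ^- q) ^+ (j * kappa)
               * cpow (eps R n ^+ j * (beta `^ (- n%:R^-1))%:C * x j)
                   (- n%:R * a)
               * F_rat ell (- a) (p%:R / n%:R) (beta%:C^-1 * x j ^+ n))).
Proof.
move=> n K; have n0 : (0 < n)%N by rewrite addn_gt0 p_ge1.
have K0 : K != 0 by exact: trinomial_const_neq0.
have Kp : 0 < cabs K by rewrite cabs_gt0.
have qC : q%:R != 0 :> R[i] by rewrite pnatr_eq0 -lt0n.
have nC : n%:R != 0 :> R[i] by rewrite pnatr_eq0 -lt0n.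
split.
- move=> fd _ a0 pd low g g0; have [_ _ fdk] := fd.
  have [] := powR_root n g0 q_ge1.
  set gam := g `^ q%:R^-1 => gam0 gamq gamV gamn c.
  have [d d0 branch] := branch_sum q fd a0.
  have [r0 r00 near1] : exists2 r0 : R, 0 < r0 & forall r, 0 < r -> r <= r0 ->
    exists2 d : R, 0 < d & forall G B : R[i], cabs (G - 1) < d ->
      cabs (B - 0) < d -> exists! u, root_near p q G B 1 r u.
    apply: trinomial_root_near1 => //; first by rewrite cabs1.
      by rewrite mulr1 natrD addrC addKr cabs_nat ler1n.
    by rewrite addr0.
  (* In the variable [u = x / c] the radius is [rho / gam]: [r0] serves uniqueness, [d] the
     expansion, and 1 keeps [u] away from 0. *)
  exists (gam * Num.min r0 (Num.min d 1)).
    by rewrite mulr_gt0// !lt_min r00 d0 ltr01.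
  move=> rho rho0; rewrite mulrC -ler_pdivrMr// !le_min => /and3P[rr rd r1].
  have [d' d'0 uniq] := near1 _ (divr_gt0 rho0 gam0) rr.
  (* Since [zeta = K t^q], this bound on [zeta] means [|t| < d']. *)
  exists (cabs K * d' ^+ q); first by rewrite mulr_gt0// exprn_gt0.
  move=> zeta beta zeta_q K_q; rewrite ltc_cabs => zd zE zq Kq zqE.
  pose t : R[i] := (gam ^- n)%:C * beta; pose om := eps R q ^+ n.
  have zt : zeta = K * t ^+ q.
    by rewrite zE /t scaled_expr gamq.
  have zqt : zeta_q = K_q * t by rewrite zqE gamn -mulrA.
  (* Coprimality enters through [gcd(q, p + q) = gcd(q, p) = 1]. *)
  have omp : q.-primitive_root om.
    rewrite prim_root_exp_coprime; last exact: eps_primitive.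
    by rewrite /n coprime_sym /coprime gcdnDr gcdnC.
  have cE (j : 'I_q) := eps_center n j beta q_ge1 gam0.
  have gG (j : 'I_q) : g%:C / c j ^+ q = 1.
    have [c0 _ cq _ _] := cE j; rewrite -[c j]/(_ * _) cq gamq divff//.
    by rewrite -cabs_eq0 cabs_real normr_eq0 gt_eqF.
  have om1 j : cabs (om ^+ j) = 1 by rewrite cabsX cabsX cabs_eps !expr1n.
  have td : cabs t < d'.
    apply: (@ltr_of_expr _ _ _ q); rewrite ?cabs_ge0 ?ltW//.
    by rewrite -(ltr_pM2l Kp) -cabsX -cabsM -zt.
  split=> [j|x hx kappa kq].
    have [c0 ca cq cn _] := cE j.
    apply: root_near_scale_uniq; first exact: c0.
    rewrite gG cn ca; apply: uniq; first by rewrite subrr cabs0.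
    by rewrite subr0 cabsM om1 mul1r.
  pose u j := x j / c j.
  have hu j : cabs (u j - 1) < rho / gam /\ u j ^+ n - u j ^+ p = om ^+ j * t.
    have [c0 ca cq cn _] := cE j.
    have /(root_near_scale _ _ _ _ _ _ c0) := hx j.
    rewrite gG cn ca /root_near ltc_cabs => -[h1 h2]; split; first exact: h1.
    by move/eqP: h2; rewrite mul1r subr_eq0 => /eqP.
  have u0 j : u j != 0.
    by apply: near1_neq0; apply: lt_le_trans r1; have [] := hu j.
  have DE : 1 - - (p%:R / q%:R) = n%:R / q%:R :> R[i] by rewrite natrD; field.
  have := branch om t zeta u omp.
  move=> /(_ (fun j => lt_le_trans (hu j).1 rd)).
  (* The exponent is the integer [p], so the principal power is an ordinary one and no branch
     question arises. *)
  have ut (j : 'I_q) : (u j ^+ q - 1) * cpow (u j) (- (q%:R * - (p%:R / q%:R))) = om ^+ j * t.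
    rewrite -(hu j).2; have -> : - (q%:R * - (p%:R / q%:R)) = p%:R :> R[i] by field.
    by rewrite cpow_nat// mulrBl mul1r -exprD addnC.
  move=> /(_ ut kappa (upper_zero p q a kappa) (lower_zero p q ell a kappa) kq).
  rewrite DE; have e1 : a + n%:R / q%:R * kappa%:R = a + n%:R * kappa%:R / q%:R.
    by rewrite mulrAC.
  rewrite e1 => /(_ (pd _ kq)).
  case=> [s|sm E].
    rewrite zt; apply: gould_hyp_zero => //; last exact: low.
    by move=> k; have := gould_poch_defined (fdk k); rewrite DE.
  split=> //; rewrite zqt exprMn -[LHS]mulrA E [LHS]mulrCA [LHS]mulrA; congr (_ * (_ * _)).
  apply: eq_bigr => j _; have [_ _ cq _ xc] := cE j.
  have uE : u j = eps R q ^+ j * (gam^-1)%:C * x j by exact: xc.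
  have uq : u j ^+ q = g%:C^-1 * x j ^+ q.
    by rewrite /u expr_div_n cq gamq mulrC.
  by rewrite uq gamV -uE.
- move=> fd _ a0 pd beta b0; have [_ _ fdk] := fd.
  have [] := powR_root q b0 n0.
  set gam := beta `^ n%:R^-1 => gam0 gamq gamV gamn c.
  have [d d0 branch] := branch_sum n fd a0.
  (* The limiting equation is now [u^n = 1], with derivative [n] at 1, instead of [u^n = u^p], with
     derivative [q]. *)
  have [r0 r00 near1] : exists2 r0 : R, 0 < r0 & forall r, 0 < r -> r <= r0 ->
    exists2 d : R, 0 < d & forall G B : R[i], cabs (G - 0) < d ->
      cabs (B - 1) < d -> exists! u, root_near p q G B 1 r u.
    apply: trinomial_root_near1 => //; first by rewrite cabs0.
      by rewrite mulr0 subr0 cabs_nat ler1n.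
    by rewrite add0r.
  exists (gam * Num.min r0 (Num.min d 1)).
    by rewrite mulr_gt0// !lt_min r00 d0 ltr01.
  move=> rho rho0; rewrite mulrC -ler_pdivrMr// !le_min => /and3P[rr rd r1].
  have [d' d'0 uniq] := near1 _ (divr_gt0 rho0 gam0) rr.
  have dn : 0 < d' ^+ n by rewrite exprn_gt0.
  (* Here [1 / zeta = t^n / K], so a large [zeta] means [|t| < d']. *)
  exists (cabs K / d' ^+ n); first by rewrite divr_gt0.
  move=> zeta g zeta_n K_n; rewrite cabsE ltcR => zd zE zn Kn znE.
  pose t : R[i] := (gam ^- q)%:C * g; pose om := eps R n ^+ q.
  have zt : zeta^-1 = K^-1 * t ^+ n.
    by rewrite zE /t scaled_expr gamq -[g ^+ n / _]invf_div -invfM.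
  have znt : zeta_n = K_n * t by rewrite znE gamn -mulrA.
  have omp : n.-primitive_root om.
    rewrite prim_root_exp_coprime; last exact: eps_primitive.
    by rewrite /n /coprime gcdnDr gcdnC.
  have cE (j : 'I_n) := eps_center q j g n0 gam0.
  have gB (j : 'I_n) : beta%:C / c j ^+ n = 1.
    have [c0 _ cn _ _] := cE j; rewrite -[c j]/(_ * _) cn gamq divff//.
    by rewrite -cabs_eq0 cabs_real normr_eq0 gt_eqF.
  have om1 j : cabs (om ^+ j) = 1 by rewrite cabsX cabsX cabs_eps !expr1n.
  have td : cabs t < d'.
    apply: (@ltr_of_expr _ _ _ n); rewrite ?cabs_ge0 ?ltW//.
    have KV : 0 < (cabs K)^-1 by rewrite invr_gt0.
    rewrite -(ltr_pM2l KV) -cabsX -cabsV -cabsM -zt cabsV [ltRHS]mulrC cabsV.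
    have z0 : 0 < cabs zeta by apply: lt_trans zd; rewrite divr_gt0.
    by rewrite -[ltRHS]invrK invf_div ltf_pV2// posrE divr_gt0.
  split=> [j|x hx kappa kn].
    have [c0 ca cn cq _] := cE j.
    apply: root_near_scale_uniq; first exact: c0.
    rewrite -/n gB cq ca; apply: uniq; last by rewrite subrr cabs0.
    by rewrite subr0 cabsM om1 mul1r.
  pose u j := x j / c j.
  have hu j : cabs (u j - 1) < rho / gam /\ u j ^+ n - om ^+ j * t * u j ^+ p = 1.
    have [c0 ca cn cq _] := cE j.
    have /(root_near_scale _ _ _ _ _ _ c0) := hx j.
    rewrite -/n gB cq ca /root_near ltc_cabs => -[h1 h2]; split; first exact: h1.
    by move/eqP: h2; rewrite subr_eq0 => /eqP.
  have u0 j : u j != 0.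
    by apply: near1_neq0; apply: lt_le_trans r1; have [] := hu j.
  have DE : 1 - p%:R / n%:R = q%:R / n%:R :> R[i].
    have -> : q%:R = n%:R - p%:R :> R[i] by rewrite natrD addrC addKr.
    by rewrite mulrBl divff.
  have := branch om t zeta^-1 u omp.
  move=> /(_ (fun j => lt_le_trans (hu j).1 rd)).
  have ut (j : 'I_n) : (u j ^+ n - 1) * cpow (u j) (- (n%:R * (p%:R / n%:R))) = om ^+ j * t.
    have -> : n%:R * (p%:R / n%:R) = p%:R :> R[i] by rewrite mulrC divfK.
    have -> : u j ^+ n - 1 = om ^+ j * t * u j ^+ p.
      by apply/eqP; rewrite subr_eq addrC -subr_eq (hu j).2.
    by rewrite cpowN cpow_nat// mulfK// expf_neq0.
  move=> /(_ ut kappa (upper_infty p q ell a kappa) (lower_infty R p q kappa) kn).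
  rewrite DE; have e1 : a + q%:R / n%:R * kappa%:R = a + q%:R * kappa%:R / n%:R.
    by rewrite mulrAC.
  rewrite e1 => /(_ (pd _ kn)).
  case=> [s|sm E].
    rewrite zt; apply: gould_hyp_infty => //.
    by move=> k; have := gould_poch_defined (fdk k); rewrite DE.
  split=> //; rewrite znt exprMn -[LHS]mulrA E [LHS]mulrCA [LHS]mulrA; congr (_ * (_ * _)).
  apply: eq_bigr => j _; have [_ _ cn _ xc] := cE j.
  have uE : u j = eps R n ^+ j * (gam^-1)%:C * x j by exact: xc.
  have un : u j ^+ n = beta%:C^-1 * x j ^+ n.
    by rewrite /u expr_div_n cn gamq mulrC.
  by rewrite un gamV -uE.
Qed.
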